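(* Let $n\ge2$, $I=[n]$, and let $W_{\mathrm{af}}$ be of type $C_n^{(1)}$. Let $i\in I$, $x,y\in(W^{I\setminus\{i\}})_{\mathrm{af}}$, $\mathcal Y_i^{C_n}(x)=(\mathsf T,c)$ and $\mathcal Y_i^{C_n}(y)=(\mathsf T',c')$. There exists an edge $x\xrightarrow{\beta}y$ in the semi-infinite Bruhat graph $\mathrm{SiB}^{I\setminus\{i\}}$ for some $\beta\in\Delta^+_{\mathrm{af}}$ if and only if one of the following conditions holds: (1) $i\in[n-1]$, $c'=c$, and there exists $s\in[i]$ such that $\mathsf T'(u)=\mathsf T(u)$ for $u\in[i]\setminus\{s\}$, $1\preceq\mathsf T(s)\prec n$, and $\mathsf T'(s)=\min\big([\mathsf T(s)+1,n]\setminus\{\|\mathsf T(u)\|\mid u\in[i],\mathsf T(u)\succeq\overline n\}\big)$. (2) $i\in[n-1]$, $c'=c$, and there exists $s\in[i]$ such that $\mathsf T'(u)=\mathsf T(u)$ for $u\in[i]\setminus\{s\}$, $\overline n\preceq\mathsf T(s)\prec\overline1$, and $\mathsf T'(s)=\sigma\big(\max([1,\|\mathsf T(s)\|-1]\setminus\{\mathsf T(u)\mid u\in[i],\mathsf T(u)\preceq n\})\big)$. (3) $i\in[2,n]$, $c'=c$, and there exist $s,t\in[i]$ such that $s<t$, $\mathsf T'(u)=\mathsf T(u)$ for $u\in[i]\setminus\{s,t\}$, and $\mathsf T'(s)=\mathsf T(s)+1=\sigma(\mathsf T(t))=\sigma(\mathsf T'(t))+1\preceq n$. (4) $c'=c$,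 and there exists $s\in[i]$ such that $\mathsf T'(u)=\mathsf T(u)$ for $u\in[i]\setminus\{s\}$ and $\sigma(\mathsf T'(s))=\mathsf T(s)=n$. (5) $c'=c+1$, $\mathsf T'(1)=1$, $\mathsf T'(u)=\mathsf T(u-1)$ for $u\in[2,i]$, and $\mathsf T(i)=\overline1$.
   Context: Write $[k]=\{1,\dots,k\}$ and $[k,l]=\{k,\dots,l\}$ (empty if $k>l$). A condition involving $\min$ or $\max$ of an empty set is not satisfied. Let $\varepsilon_1,\dots,\varepsilon_n$ be an orthonormal basis of $\mathbb{R}^n$, $\Delta=\{\pm(\varepsilon_s\pm\varepsilon_t)\mid s<t\}\sqcup\{\pm2\varepsilon_s\}$, simple roots $\alpha_s=\varepsilon_s-\varepsilon_{s+1}$ ($s\le n-1$), $\alpha_n=2\varepsilon_n$, coroots $\gamma^\vee=2\gamma/(\gamma,\gamma)$, $Q^\vee=\bigoplus_{i}\mathbb{Z}\alpha_i^\vee$, $c_i(\xi)$ the coefficient of $\alpha_i^\vee$ in $\xi$. $\mathcal C_n=\{1\prec\cdots\prec n\prec\overline n\prec\cdots\prec\overline1\}$, $\sigma:s\leftrightarrow\overline s$, $\|s\|=\|\overline s\|=s$. Identifying $s=\varepsilon_s$, $\overline s=-\varepsilon_s$, $W=\{w\in\mathfrak S(\mathcal C_n)\mid w\sigma=\sigma w\}$. $W_{\mathrm{af}}=W\ltimes\{t_\xi\mid\xi\in Q^\vee\}$, $\Delta^+_{\mathrm{af}}=\Delta^+\sqcup\{\alpha+m\delta\mid\alpha\in\Delta,m>0\}$,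 $wt_\xi(\alpha+m\delta)=w\alpha+(m-\langle\xi,\alpha\rangle)\delta$, $r_{\alpha+m\delta}=r_\alpha t_{m\alpha^\vee}$. For $J\subset I$, with $\Delta_J=\Delta\cap\bigoplus_{j\in J}\mathbb{Z}\alpha_j$: $(W^J)_{\mathrm{af}}=\{x\in W_{\mathrm{af}}\mid x\beta\in\Delta^+_{\mathrm{af}}\ \forall\beta\in(\Delta_J\cap\Delta^+)\sqcup\{\alpha+m\delta\mid\alpha\in\Delta_J,m>0\}\}$. $\ell^{\frac{\infty}{2}}(wt_\xi)=\ell(w)+2\langle\xi,\rho\rangle$ with $\rho=\frac12\sum_{\alpha\in\Delta^+}\alpha$. $\mathrm{SiB}^J$ is the directed graph on $(W^J)_{\mathrm{af}}$ with edges $x\xrightarrow{\beta}r_\beta x$ for $\beta\in\Delta^+_{\mathrm{af}}$, $x,r_\beta x\in(W^J)_{\mathrm{af}}$, $\ell^{\frac{\infty}{2}}(r_\beta x)=\ell^{\frac{\infty}{2}}(x)+1$. $\mathrm{CST}_{C_n}(\varpi_i)$ is the set of $i$-element subsets $\mathsf T=\{\mathsf T(1)\prec\cdots\prec\mathsf T(i)\}\subset\mathcal C_n$ with $\|\mathsf T(u)\|$ all distinct; $\mathsf T^{(i)}_w=\{w(1),\dots,w(i)\}$; $\mathcal Y_i^{C_n}(wt_\xi)=(\mathsf T^{(i)}_w,c_i(\xi))\in\mathrm{CST}_{C_n}(\varpi_i)\times\mathbb{Z}$. *)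

(* Defs.v *)
From mathcomp Require Import all_boot all_order all_fingroup all_algebra.
From mathcomp Require Import boolp reals.

Set Implicit Arguments.
Unset Strict Implicit.
Unset Printing Implicit Defensive.

Import Order.TTheory GRing.Theory Num.Theory.
Local Open Scope ring_scope.

(* All indices are shifted down by one: s in [n] is the ordinal s - 1 : 'I_n.
   The alphabet C_n = {1 < ... < n < nbar < ... < 1bar} is 'I_(n + n) with its
   natural order: s is the ordinal s - 1 and sbar is the ordinal 2n - s. *)
Notation letter n := 'I_(n + n).

Definition sigma n (a : letter n) : letter n := rev_ord a.

(* [n] is regarded as a subset of C_n, so || || takes its values in C_n. *)
Definition lnorm n (a : letter n) : letter n := if (a < n)%N then a else sigma a.

Lemma sigma_inj n : injective (@sigma n).
Proof. exact: rev_ord_inj. Qed.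

(* W, as a finGroupType: the centraliser of sigma in S(C_n). *)
Notation weyl n := (subg_of 'C[perm (@sigma_inj n)]).

Definition wfun n (w : weyl n) : letter n -> letter n := fun a => sgval w a.

(* Composition w o v; the product of permutations in the library composes in
   the opposite order. *)
Definition wcomp n (w v : weyl n) : weyl n := (v * w)%g.

Section RootSystem.
Variables (R : realType) (n : nat).
Implicit Types (u v g xi : 'rV[R]_n) (w : weyl n) (J : {set 'I_n}).

Definition dot u v : R := \sum_(j < n) u 0 j * v 0 j.

(* eps k is the (k+1)-st vector of the standard basis, for k < n. *)
Definition eps (k : nat) : 'rV[R]_n := \row_(j < n) (j == k :> nat)%:R.

Definition simple_root (s : 'I_n) : 'rV[R]_n :=
  if (s.+1 < n)%N then eps s - eps s.+1 else 2 *: eps s.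

Definition simple_roots : n.-tuple 'rV[R]_n := [tuple simple_root s | s < n].

(* [undup] only ensures that each root occurs once. *)
Definition roots : seq 'rV[R]_n :=
  let pairs := [seq p : 'I_n * 'I_n <- enum {: 'I_n * 'I_n} | (p.1 < p.2)%N] in
  let half := [seq eps p.1 + eps p.2 | p : 'I_n * 'I_n <- pairs]
           ++ [seq eps p.1 - eps p.2 | p : 'I_n * 'I_n <- pairs]
           ++ [seq 2 *: eps s | s : 'I_n] in
  undup (half ++ [seq - g | g <- half]).

Definition pos_roots : seq 'rV[R]_n :=
  [seq g <- roots | [forall j, 0 <= coord simple_roots j g]].

Definition rho : 'rV[R]_n := 2^-1 *: \sum_(g <- pos_roots) g.

Definition in_root_sub J g : Prop :=
  g \in roots /\
  exists k : 'I_n -> int, g = \sum_(j in J) (k j)%:~R *: simple_root j.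

Definition coroot g : 'rV[R]_n := (2 / dot g g) *: g.

Definition simple_coroots : n.-tuple 'rV[R]_n :=
  [tuple coroot (simple_root s) | s < n].

Definition coroot_lattice xi : Prop :=
  exists k : 'I_n -> int, xi = \sum_j (k j)%:~R *: coroot (simple_root j).

(* The coordinate is already an integer when xi lies in the coroot lattice. *)
Definition coroot_coef (i : 'I_n) xi : int :=
  Num.floor (coord simple_coroots i xi).

(* The identification s = eps_s, sbar = - eps_s. *)
Definition lvec (a : letter n) : 'rV[R]_n :=
  if (a < n)%N then eps a else - eps (sigma a).

Definition wact w v : 'rV[R]_n := \sum_(s < n) v 0 s *: lvec (wfun w (lshift n s)).

Definition reflect g v : 'rV[R]_n := v - dot (coroot g) v *: g.

(* The element of W that acts on R^n as the reflection in the root g. *)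
Definition wrefl g : weyl n :=
  odflt 1%g [pick w : weyl n |
              [forall a, lvec (wfun w a) == reflect g (lvec a)]].

Definition word (s : seq 'I_n) : weyl n :=
  foldr (fun j w => wcomp (wrefl (simple_root j)) w) 1%g s.

Definition has_word w (k : nat) : bool :=
  [exists s : k.-tuple 'I_n, word s == w].

(* The length of w as an element of the Coxeter group W; the second branch is
   never taken, since the simple reflections generate W. *)
Definition wlength w : nat :=
  if pselect (exists k, has_word w k) is left h then ex_minn h else 0%N.

(* The pair (w, xi) stands for w t_xi; it belongs to W_af when xi lies in the
   coroot lattice. *)
Definition waf : Type := (weyl n * 'rV[R]_n)%type.

Definition in_Waf (x : waf) : Prop := coroot_lattice x.2.

(* w t_xi v t_zeta = (w v) t_(v^-1 xi + zeta) *)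
Definition waf_mul (x y : waf) : waf :=
  (wcomp x.1 y.1, wact (y.1)^-1%g x.2 + y.2).

(* The pair (g, m) stands for g + m delta. *)
Definition aff : Type := ('rV[R]_n * R)%type.

Definition pos_aff_root (b : aff) : Prop :=
  (b.1 \in pos_roots /\ b.2 = 0)
  \/ (b.1 \in roots /\ exists2 m : int, 0 < m & b.2 = m%:~R).

Definition waf_act (x : waf) (b : aff) : aff :=
  (wact x.1 b.1, b.2 - dot x.2 b.1).

Definition waf_refl (b : aff) : waf := (wrefl b.1, b.2 *: coroot b.1).

Definition in_WJaf J (x : waf) : Prop :=
  in_Waf x /\
  forall b : aff, pos_aff_root b -> in_root_sub J b.1 ->
    pos_aff_root (waf_act x b).

Definition si_length (x : waf) : R := (wlength x.1)%:R + 2 * dot x.2 rho.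

Definition SiB_edge J (x : waf) (b : aff) (y : waf) : Prop :=
  [/\ pos_aff_root b, in_WJaf J x, in_WJaf J y,
      y = waf_mul (waf_refl b) x & si_length y = si_length x + 1].

End RootSystem.

(* CST_{C_n}(varpi_k) *)
Definition is_CST n k (T : {set letter n}) : bool :=
  (#|T| == k) && dinjectiveb (@lnorm n) T.

Definition CST (n k : nat) : Type := {T : {set letter n} | is_CST k T}.

Lemma card_CST n k (T : CST n k) : #|val T| = k.
Proof. by case: T => T /= /andP[/eqP]. Qed.

(* The (u+1)-st smallest element of T: [enum_val] enumerates a set of ordinals
   in increasing order. *)
Definition entry n k (T : CST n k) (u : 'I_k) : letter n :=
  enum_val (cast_ord (esym (card_CST T)) u).

Lemma wfun_inj n (w : weyl n) : injective (wfun w).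
Proof. exact: perm_inj. Qed.

Lemma wfun_sigma n (w : weyl n) a : wfun w (sigma a) = sigma (wfun w a).
Proof.
have /cent1P/permP/(_ a) := valP w.
by rewrite !permM !permE.
Qed.

(* The set {w(1), ..., w(i+1)}. *)
Definition tableau_set n (i : 'I_n) (w : weyl n) : {set letter n} :=
  [set wfun w (lshift n u) | u : 'I_n & (u <= i)%N].

Lemma tableau_subproof n (i : 'I_n) (w : weyl n) :
  is_CST i.+1 (tableau_set i w).
Proof.
rewrite /is_CST /tableau_set; apply/andP; split.
  rewrite card_imset => [|u v /wfun_inj /lshift_inj //].
  rewrite -sum1dep_card -(big_ord_widen_leq _ xpredT (fun=> 1%N)) //.
  by rewrite sum1_card card_ord.
apply/dinjectiveP => _ _ /imsetP[u _ ->] /imsetP[v _ ->] e.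
have lnE (b : letter n) : lnorm b = b \/ lnorm b = sigma b.
  by rewrite /lnorm; case: ifP; [left|right].
have sK : cancel (@sigma n) (@sigma n) by exact: rev_ordK.
have bad (p q : 'I_n) : wfun w (lshift n p) <> sigma (wfun w (lshift n q)).
  rewrite -wfun_sigma => /wfun_inj/(congr1 val) /= ep.
  have := ltn_ord p; rewrite ep ltnNge => /negP; apply.
  by rewrite -addnBA // leq_addr.
move: e; have [->|->] := lnE (wfun w (lshift n u));
  have [->|->] := lnE (wfun w (lshift n v)) => //.
- by move/bad.
- by move/esym/bad.
- by move/(can_inj sK).
Qed.

Definition tableau n (i : 'I_n) (w : weyl n) : CST n i.+1 :=
  exist (is_CST i.+1) _ (tableau_subproof i w).

Definition Ymap (R : realType) n (i : 'I_n) (x : waf R n) : CST n i.+1 * int :=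
  (tableau i x.1, coroot_coef i x.2).

Definition is_min n (A : {set letter n}) (a : letter n) : Prop :=
  a \in A /\ forall b, b \in A -> (a <= b)%N.

Definition is_max n (A : {set letter n}) (a : letter n) : Prop :=
  a \in A /\ forall b, b \in A -> (b <= a)%N.

(* Main.v *)
(* The root attached to letters p <> q is p - q, so that roots are positive when
   p < q and reflections swap p with q and sigma p with sigma q.  An element
   w t_xi lies in (W^J)_af exactly when kappa(a) = w(a) + 2n <xi, a> satisfies
   kappa(a) < kappa(b) < kappa(a) + 2n for letters a < b in a common block of
   {1..i}, the middle letters, and their sigma-image; hence it is determined by its
   tableau T and by c = c_i(xi).  Since [w g < 0] + <xi, g> = 0 for the positive
   roots g of Delta_J, the semi-infinite length is a function of (T, c):
     2 l = 2 sum_(a in T) a - #{(a, b) in T^2 | a <> b, a > sigma b}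
           + 2 (2n - i + 1) c + const.
   A reflection either exchanges a in T with a letter b, where b, sigma b are not
   in T, or replaces a by sigma a, or replaces a, b by sigma b, sigma a.  In each
   case the variation of l is compared with the number of letters of T and
   sigma T in the intervals through which a and b move; it equals 1 only in the
   five situations of the statement, the last one being a = 1bar with c raised
   by 1. *)
Require Import Defs.
From mathcomp Require Import all_boot all_order all_fingroup all_algebra.
From mathcomp Require Import boolp reals zify ring lra.

Set Implicit Arguments.
Unset Strict Implicit.
Unset Printing Implicit Defensive.

Import Order.TTheory GRing.Theory Num.Theory.
Local Open Scope ring_scope.

(** * Letters and signed permutations *)

(** In the code the index counts from 0, so one unit of [c] costs [n + n - i] in length. What
    excludes almost every change of [c] is a count from both sides. When [a] goes to [sigma a], or
    [a, b] to [sigma b, sigma a], the remaining letters of T and their [sigma]-images are distinct;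
    hence a short interval contains few of them and a long interval must contain many. The tableau
    term therefore cannot drop far enough to offset the cost of [c], except that 1bar going to 1
    leaves exactly 1. An exchange with a middle letter cannot change [c], because [xi] pairs to 0
    with the middle letters. Edges multiply by a reflection on the left; conjugation moves it to the
    right, where it is named by letters p, q before w is applied, and where the blocks are visible.
    For the converse the tableaux of x and y are known, but not the relation between x and y. The
    candidate obtained from x by a reflection is shown to lie in (W^J)_af with the tableau and the
    coefficient of y, and injectivity identifies it with y. *)

Lemma sigmaE n (a : letter n) : sigma a = (n + n - a.+1)%N :> nat.
Proof. by []. Qed.

Lemma sigmaK n : involutive (@sigma n).
Proof. exact: rev_ordK. Qed.

Lemma sigma_eq n (a b : letter n) : (sigma a == b) = (a == sigma b).
Proof. by rewrite (can2_eq (@sigmaK n) (@sigmaK n)). Qed.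

Lemma sigma_neq n (a : letter n) : (sigma a == a) = false.
Proof.
by apply/eqP => /(congr1 val); rewrite /= ; have := ltn_ord a; lia.
Qed.

Lemma neq_sigma n (a : letter n) : (a == sigma a) = false.
Proof. by rewrite eq_sym sigma_neq. Qed.

Lemma ltn_sigma n (a b : letter n) : (sigma a < sigma b)%N = (b < a)%N.
Proof. by rewrite !sigmaE; have := ltn_ord a; have := ltn_ord b; lia. Qed.

Lemma sigma_geq n (a : letter n) : (n <= sigma a)%N = (a < n)%N.
Proof. by rewrite !sigmaE; have := ltn_ord a; lia. Qed.

Lemma sigma_ltn n (a : letter n) : (sigma a < n)%N = (n <= a)%N.
Proof. by rewrite !sigmaE; have := ltn_ord a; lia. Qed.

Lemma letter_lshift n (a : letter n) : (a < n)%N -> {s : 'I_n | a = lshift n s}.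
Proof. by move=> h; exists (Ordinal h); apply: val_inj. Qed.

(** When [b = sigma a] the first two tests already catch every moved letter, so one formula serves
    the reflections in short and in long roots. *)
Definition sw n (a b c : letter n) : letter n :=
  if c == a then b else if c == b then a else
  if c == sigma a then sigma b else if c == sigma b then sigma a else c.

Lemma swl n (a b : letter n) : sw a b a = b.
Proof. by rewrite /sw eqxx. Qed.

Lemma swC n (a b : letter n) : sw a b =1 sw b a.
Proof.
by move=> c; rewrite /sw; do ![case: eqVneq => //= ?; subst] => //;
  try (by rewrite sigmaK).
Qed.

Lemma swr n (a b : letter n) : sw a b b = a.
Proof. by rewrite swC swl. Qed.

Lemma sw_sigma n (a b c : letter n) : sw a b (sigma c) = sigma (sw a b c).
Proof.
apply/val_inj; rewrite /sw -!val_eqE.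
have := ltn_ord a; have := ltn_ord b; have := ltn_ord c.
by do !case: ifP; rewrite /=; lia.
Qed.

Lemma sw_sigma2 n (a b : letter n) : sw (sigma a) (sigma b) =1 sw a b.
Proof.
move=> c; apply/val_inj; rewrite /sw -!val_eqE.
have := ltn_ord a; have := ltn_ord b; have := ltn_ord c.
by do !case: ifP; rewrite /=; lia.
Qed.

Lemma swK n (a b : letter n) : involutive (sw a b).
Proof.
move=> c; apply/val_inj; rewrite /sw -!val_eqE.
have := ltn_ord a; have := ltn_ord b; have := ltn_ord c.
by do !case: ifP; rewrite /=; lia.
Qed.

Lemma sw_out n (a b c : letter n) :
  c != a -> c != b -> c != sigma a -> c != sigma b -> sw a b c = c.
Proof. by rewrite /sw => /negbTE-> /negbTE-> /negbTE-> /negbTE->. Qed.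

(** Reflections are permuted by conjugation: w carries the reflection in [a - b] to that in
    [w a - w b]. This turns a reflection on the left of an element into one on its right. *)
Lemma sw_conj n (f : letter n -> letter n) (a b c : letter n) :
  injective f -> (forall a, f (sigma a) = sigma (f a)) ->
  sw (f a) (f b) (f c) = f (sw a b c).
Proof. by move=> fI fs; rewrite /sw -!fs !(inj_eq fI) -!(fun_if f). Qed.

(** [subg] returns the identity outside the group; [wfun_wsw] checks that [sw a b] commutes with
    [sigma], so this default does not occur. *)
Definition wsw n (a b : letter n) : weyl n :=
  subg _ (perm (can_inj (@swK n a b))).

Lemma wfun_wsw n (a b c : letter n) : wfun (wsw a b) c = sw a b c.
Proof.
rewrite /wfun /wsw subgK ?permE //.
by apply/cent1P/permP => d; rewrite !permM !permE sw_sigma.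
Qed.

Lemma weylP n (w v : weyl n) : wfun w =1 wfun v -> w = v.
Proof. by move=> e; apply: val_inj; apply/permP. Qed.

Lemma wfun_comp n (w v : weyl n) a : wfun (wcomp w v) a = wfun w (wfun v a).
Proof. by rewrite /wfun /wcomp /= permM. Qed.

Lemma wfun1 n a : wfun (1%g : weyl n) a = a.
Proof. by rewrite /wfun /= perm1. Qed.

Lemma wfunV n (w : weyl n) a : wfun w^-1%g (wfun w a) = a.
Proof. by rewrite /wfun /= permK. Qed.

Lemma wfunKV n (w : weyl n) a : wfun w (wfun w^-1%g a) = a.
Proof. by rewrite /wfun /= permKV. Qed.

Lemma ord_lt_neq n (a b : 'I_n) : (a < b)%N -> a != b.
Proof. by move=> h; rewrite -val_eqE neq_ltn h. Qed.

Lemma ord_gt_neq n (a b : 'I_n) : (a < b)%N -> b != a.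
Proof. by rewrite eq_sym; exact: ord_lt_neq. Qed.

Lemma ord_neq_lt n (a b : 'I_n) : a != b -> (a < b)%N \/ (b < a)%N.
Proof. by rewrite -val_eqE neq_ltn => /orP. Qed.

(** * Roots as differences of letters *)

Lemma dotC (R : realType) n (u v : 'rV[R]_n) : dot u v = dot v u.
Proof. by apply: eq_bigr => j _; rewrite mulrC. Qed.

Lemma dotDl (R : realType) n (u v w : 'rV[R]_n) : dot (u + v) w = dot u w + dot v w.
Proof. by rewrite -big_split; apply: eq_bigr => j _; rewrite mxE mulrDl. Qed.

Lemma dotZl (R : realType) n k (u v : 'rV[R]_n) : dot (k *: u) v = k * dot u v.
Proof. by rewrite mulr_sumr; apply: eq_bigr => j _; rewrite mxE mulrA. Qed.

Lemma dotNl (R : realType) n (u v : 'rV[R]_n) : dot (- u) v = - dot u v.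
Proof. by rewrite -scaleN1r dotZl mulN1r. Qed.

Lemma dotNr (R : realType) n (u v : 'rV[R]_n) : dot u (- v) = - dot u v.
Proof. by rewrite dotC dotNl dotC. Qed.

Lemma dotBl (R : realType) n (u v w : 'rV[R]_n) : dot (u - v) w = dot u w - dot v w.
Proof. by rewrite dotDl dotNl. Qed.

Lemma dotBr (R : realType) n (u v w : 'rV[R]_n) : dot u (v - w) = dot u v - dot u w.
Proof. by rewrite dotC dotBl ![dot _ u]dotC. Qed.

Lemma dotZr (R : realType) n k (u v : 'rV[R]_n) : dot u (k *: v) = k * dot u v.
Proof. by rewrite dotC dotZl dotC. Qed.

Lemma dot_sumr (R : realType) n (u : 'rV[R]_n) (I : Type) (r : seq I) (P : pred I) F :
  dot u (\sum_(x <- r | P x) F x) = \sum_(x <- r | P x) dot u (F x).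
Proof.
elim/big_rec2: _ => [|x v w _ <-]; last by rewrite dotC dotDl ![dot _ u]dotC.
by rewrite /dot big1 // => j _; rewrite mxE mulr0.
Qed.

Lemma eps0j (R : realType) n k (j : 'I_n) : eps R n k 0 j = (j == k :> nat)%:R.
Proof. by rewrite mxE. Qed.

Lemma dot_eps (R : realType) n (v : 'rV[R]_n) (s : 'I_n) : dot v (eps R n s) = v 0 s.
Proof.
rewrite /dot (bigD1 s) //= eps0j eqxx mulr1 big1 ?addr0 // => j js.
by rewrite eps0j val_eqE (negbTE js) mulr0.
Qed.

Lemma lvec_sigma (R : realType) n (a : letter n) : lvec R (sigma a) = - lvec R a.
Proof.
rewrite /lvec sigma_ltn sigmaK; case: ltnP => // _; by rewrite opprK.
Qed.

Lemma lvec_lshift (R : realType) n (s : 'I_n) : lvec R (lshift n s) = eps R n s.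
Proof. by rewrite /lvec /= ltn_ord. Qed.

Variant letter_spec n : letter n -> Type :=
  | LetterPos s : letter_spec (lshift n s)
  | LetterNeg s : letter_spec (sigma (lshift n s)).

Lemma letterP n (a : letter n) : letter_spec a.
Proof.
have [/letter_lshift[s ->]|] := ltnP a n; first exact: LetterPos.
by rewrite -sigma_ltn => /letter_lshift[s e]; rewrite -(sigmaK a) e; exact: LetterNeg.
Qed.

Lemma lshift_neq_sigma n (s t : 'I_n) : (lshift n s == sigma (lshift n t)) = false.
Proof. by rewrite -val_eqE /=; have := ltn_ord s; have := ltn_ord t; lia. Qed.

Lemma dot_lvec (R : realType) n (a b : letter n) :
  dot (lvec R a) (lvec R b) = (a == b)%:R - (a == sigma b)%:R.
Proof.
have sI := can_inj (@sigmaK n).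
case: (letterP a) => s; case: (letterP b) => t;
  rewrite ?lvec_sigma ?dotNl ?dotNr !lvec_lshift dot_eps eps0j ?sigmaK
          ?(inj_eq sI) ?sigma_eq ?sigmaK ?lshift_neq_sigma ?(inj_eq (@lshift_inj _ _)) -?val_eqE /=
          [t == s :> nat]eq_sym; ring.
Qed.

Lemma lvec_inj (R : realType) n : injective (@lvec R n).
Proof.
move=> a b /(congr1 (dot (lvec R a))); rewrite !dot_lvec eqxx neq_sigma.
case: eqVneq => // _; case: (a == sigma b) => /= h; exfalso; move: h; clear; lra.
Qed.

Definition rt (R : realType) n (a b : letter n) : 'rV[R]_n := lvec R a - lvec R b.

Lemma rt_opp (R : realType) n (a b : letter n) : - rt R a b = rt R b a.
Proof. by rewrite /rt opprB. Qed.

Lemma rt_sigma (R : realType) n (a b : letter n) : rt R (sigma b) (sigma a) = rt R a b.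
Proof. by rewrite /rt !lvec_sigma opprK addrC. Qed.

(** The pairing of [a] with [a - b] is 1 or 2, while its pairing with [c - d] is positive only if
    [a] is [c] or [sigma d]. *)
Lemma rt_inj (R : realType) n (a b c d : letter n) : a != b ->
  rt R a b = rt R c d -> (c = a /\ d = b) \/ (c = sigma b /\ d = sigma a).
Proof.
move=> ab e; have := congr1 (dot (lvec R a)) e.
rewrite /rt !dotBr !dot_lvec eqxx neq_sigma (negbTE ab).
have [ac _|ac] := eqVneq a c.
  left; split=> //; move: e; rewrite /rt ac => /addrI/oppr_inj/lvec_inj //.
have [ad _|ad] := eqVneq a (sigma d).
  right; rewrite ad sigmaK; split=> //; apply: (@lvec_inj R); rewrite lvec_sigma.
  move: e; rewrite /rt ad lvec_sigma addrC => /addIr <-. by [].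
by case: (a == sigma b); case: (a == sigma c); case: (a == d) => /= h; exfalso; move: h; clear; lra.
Qed.

(** A short root has square length 2 and is its own coroot; a long root [a - sigma a] is twice the
    vector of [a], has square length 4, and its coroot is that vector. *)
Definition rt_coroot (R : realType) n (a b : letter n) : 'rV[R]_n :=
  if b == sigma a then lvec R a else rt R a b.

Lemma coroot_rt (R : realType) n (a b : letter n) : a != b ->
  coroot (rt R a b) = rt_coroot R a b.
Proof.
move=> ab; rewrite /coroot /rt_coroot {1 2}/rt !dotBl !dotBr !dot_lvec !eqxx !neq_sigma.
rewrite [b == a]eq_sym (negbTE ab) [a == sigma b]eq_sym sigma_eq.
have [->|_] := eqVneq b (sigma a); last first.
  by rewrite -[RHS]scale1r; congr (_ *: _); rewrite /=; field.
rewrite /rt lvec_sigma opprK -mulr2n -scaler_nat scalerA -[RHS]scale1r; congr (_ *: _).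
by rewrite /=; field.
Qed.

Lemma dot_rt_coroot (R : realType) n (a b c : letter n) : a != b ->
  dot (rt_coroot R a b) (lvec R c) *: rt R a b = lvec R c - lvec R (sw a b c).
Proof.
move=> ab; rewrite /rt_coroot; have sI := can_inj (@sigmaK n).
case: (eqVneq b (sigma a)) => [->|bs]; rewrite /rt ?dotBl !dot_lvec /sw ?sigmaK.
  have [->|ca] := eqVneq c a.
    by rewrite ?eqxx neq_sigma subr0 scale1r.
  have [->|cs] := eqVneq c (sigma a).
    by rewrite sigmaK eqxx sub0r scaleN1r opprB.
  by rewrite -sigma_eq eq_sym (negbTE cs) !subrr scale0r.
have [->|ca] := eqVneq c a.
  by rewrite neq_sigma [b == a]eq_sym (negbTE ab) (negbTE bs) !subr0 scale1r.
have [->|cb] := eqVneq c b.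
  by rewrite neq_sigma -sigma_eq eq_sym (negbTE bs) !subr0 sub0r scaleN1r opprB.
rewrite -![_ == sigma c]sigma_eq ![sigma _ == c]eq_sym.
have [->|cas] := eqVneq c (sigma a).
  by rewrite (inj_eq sI) (negbTE ab) !subr0 sub0r scaleN1r opprB !lvec_sigma opprK addrC.
have [->|cbs] := eqVneq c (sigma b).
  by rewrite subrr sub0r opprB subr0 scale1r !lvec_sigma opprK addrC.
by rewrite !subr0 scale0r subrr.
Qed.

Lemma reflect_rt (R : realType) n (a b c : letter n) : a != b ->
  Defs.reflect (rt R a b) (lvec R c) = lvec R (sw a b c).
Proof.
by move=> ab; rewrite /Defs.reflect coroot_rt // dot_rt_coroot // opprB addrC subrK.
Qed.

Lemma wrefl_rt (R : realType) n (a b : letter n) : a != b ->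
  wrefl (rt R a b) = wsw a b.
Proof.
move=> ab; rewrite /wrefl; case: pickP => [w /forallP h|/(_ (wsw a b))] /=.
  apply: weylP => c; rewrite wfun_wsw; apply: (@lvec_inj R).
  by rewrite (eqP (h c)) reflect_rt.
by move/forallP; case=> c; rewrite wfun_wsw reflect_rt.
Qed.

Lemma eps_wact (R : realType) n (w : weyl n) (s : 'I_n) :
  wact w (eps R n s) = lvec R (wfun w (lshift n s)).
Proof.
rewrite /wact (bigD1 s) //= eps0j eqxx scale1r big1 ?addr0 // => t ts.
by rewrite eps0j val_eqE (negbTE ts) scale0r.
Qed.

Lemma wactD (R : realType) n (w : weyl n) (u v : 'rV[R]_n) : wact w (u + v) = wact w u + wact w v.
Proof. by rewrite -big_split; apply: eq_bigr => s _; rewrite mxE scalerDl. Qed.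

Lemma wactZ (R : realType) n (w : weyl n) k (u : 'rV[R]_n) : wact w (k *: u) = k *: wact w u.
Proof. by rewrite scaler_sumr; apply: eq_bigr => s _; rewrite mxE scalerA. Qed.

Lemma wactN (R : realType) n (w : weyl n) (u : 'rV[R]_n) : wact w (- u) = - wact w u.
Proof. by rewrite -scaleN1r wactZ scaleN1r. Qed.

Lemma wact_lvec (R : realType) n (w : weyl n) a : wact w (lvec R a) = lvec R (wfun w a).
Proof.
case: (letterP a) => s; last rewrite wfun_sigma !lvec_sigma wactN;
 by rewrite lvec_lshift eps_wact.
Qed.

Lemma wact_rt (R : realType) n (w : weyl n) a b : wact w (rt R a b) = rt R (wfun w a) (wfun w b).
Proof. by rewrite /rt wactD wactN !wact_lvec. Qed.

Lemma wact_rt_coroot (R : realType) n (w : weyl n) a b :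
  wact w (rt_coroot R a b) = rt_coroot R (wfun w a) (wfun w b).
Proof.
by rewrite /rt_coroot -wfun_sigma (inj_eq (@wfun_inj _ w)); case: ifP; rewrite ?wact_lvec ?wact_rt.
Qed.

(** * Simple roots, positive roots, coroot lattice *)

Lemma nx_proof n (s : 'I_n) : (s.+1 < n + n)%N.
Proof. by have := ltn_ord s; lia. Qed.

(* The letter after s: for s = n it is nbar, so that alpha_s is always the
   difference of two consecutive letters. *)
Definition nx n (s : 'I_n) : letter n := Ordinal (nx_proof s).

Lemma lshift_nx n (s : 'I_n) : lshift n s != nx s.
Proof. by rewrite -val_eqE /=; lia. Qed.

Lemma nx_sigma n (s : 'I_n) : (nx s == sigma (lshift n s)) = ~~ (s.+1 < n)%N.
Proof. by rewrite -val_eqE /=; have := ltn_ord s; lia. Qed.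

Lemma simple_rootE (R : realType) n (s : 'I_n) :
  simple_root R s = rt R (lshift n s) (nx s).
Proof.
rewrite /simple_root /rt lvec_lshift; case: ltnP => h.
  have -> : nx s = lshift n (Ordinal h) by apply: val_inj.
  by rewrite lvec_lshift.
have -> : nx s = sigma (lshift n s) by apply/eqP; rewrite nx_sigma -leqNgt.
by rewrite lvec_sigma lvec_lshift opprK -mulr2n scaler_nat.
Qed.

(** Partial sums are the coordinates of a vector on the simple coroots; on the simple roots the last
    one is halved, because alpha_n is twice a basis vector. *)
Definition psum (R : realType) n (k : nat) (v : 'rV[R]_n) : R :=
  \sum_(l < n | (l <= k)%N) v 0 l.

Lemma psumD (R : realType) n k (u v : 'rV[R]_n) : psum k (u + v) = psum k u + psum k v.
Proof. by rewrite -big_split; apply: eq_bigr => s _; rewrite mxE. Qed.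

Lemma psumN (R : realType) n k (u : 'rV[R]_n) : psum k (- u) = - psum k u.
Proof. by rewrite -sumrN; apply: eq_bigr => s _; rewrite mxE. Qed.

Lemma psum_eps (R : realType) n k (s : 'I_n) : psum k (eps R n s) = (s <= k)%N%:R.
Proof.
rewrite /psum big_mkcond (bigD1 s) //= eps0j eqxx big1 ?addr0; first by case: ifP.
by move=> t ts; rewrite eps0j val_eqE (negbTE ts) if_same.
Qed.

Lemma psum_lvec (R : realType) n k (a : letter n) : (k < n)%N ->
  psum k (lvec R a) = (a <= k)%N%:R - (sigma a <= k)%N%:R.
Proof.
move=> kn; case: (letterP a) => s; rewrite ?lvec_sigma ?psumN lvec_lshift psum_eps ?sigmaK /=.
  have -> : (n + n - s.+1 <= k)%N = false by have := ltn_ord s; lia.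
  by rewrite subr0.
have -> : (n + n - s.+1 <= k)%N = false by have := ltn_ord s; lia.
by rewrite sub0r.
Qed.

Lemma psum_rt (R : realType) n k (a b : letter n) : (k < n)%N ->
  psum k (rt R a b) =
  ((a <= k)%N%:R - (sigma a <= k)%N%:R) - ((b <= k)%N%:R - (sigma b <= k)%N%:R).
Proof. by move=> kn; rewrite /rt psumD psumN !psum_lvec. Qed.

(** Abel summation: the left side is the difference of two consecutive partial sums. Index 0 is
    treated apart, having no predecessor. *)
Lemma psum_expand (R : realType) n (v : 'rV[R]_n) (j : 'I_n) :
  \sum_(s < n) psum s v * ((j == s)%:R - (j == s.+1 :> nat)%:R) = v 0 j.
Proof.
under eq_bigr do rewrite mulrBr; rewrite sumrB.
rewrite (bigD1 j) //= eqxx mulr1 big1 ?addr0; last first.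
  by move=> s sj; rewrite eq_sym (negbTE sj) mulr0.
apply/eqP; rewrite subr_eq /psum (bigD1 j) //=; apply/eqP; congr (_ + _).
case: (posnP j) => [j0|j_gt0].
  rewrite big_pred0 ?big1 // => [s _|s]; last by rewrite -val_eqE /= j0; case: (s : nat).
  by rewrite j0 mulr0.
have h : (j.-1 < n)%N by have := ltn_ord j; lia.
rewrite [RHS](bigD1 (Ordinal h)) //= prednK // eqxx mulr1 [X in _ + X]big1 ?addr0.
  apply: eq_bigl => l; rewrite -val_eqE /=.
  by move: j_gt0; clear; lia.
move=> s; rewrite -val_eqE /= => sj.
have -> : (j == s.+1 :> nat) = false by move: sj j_gt0; clear; lia.
by rewrite mulr0.
Qed.

(** An expansion formula shows that the n vectors span, hence are free by dimension, and so its
    coefficients are the coordinates. *)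
Lemma coord_expand (R : realType) n (X : n.-tuple 'rV[R]_n) (f : 'I_n -> 'rV[R]_n -> R) :
  (forall v, v = \sum_s f s v *: X`_s) -> free X /\ forall j v, coord X j v = f j v.
Proof.
move=> fX; have XF : free X.
  rewrite /free size_tuple.
  have -> : <<X>>%VS = fullv.
    apply/eqP; rewrite eqEsubv subvf; apply/subvP => v _; rewrite [v]fX.
    apply: memv_suml => s _; apply: memvZ; apply: memv_span.
    by rewrite mem_nth // size_tuple.
  by rewrite dimvf /= /dim /= mul1n.
by split=> // j v; rewrite {1}[v]fX coord_sum_free.
Qed.

Lemma simple_root0j (R : realType) n (s j : 'I_n) :
  simple_root R s 0 j = (if (s.+1 < n)%N then 1 else 2) * ((j == s)%:R - (j == s.+1 :> nat)%:R).
Proof.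
rewrite /simple_root; case: ltnP => h; rewrite !mxE ?mul1r //.
have -> : (j == s.+1 :> nat) = false by have := ltn_ord j; lia.
by rewrite subr0.
Qed.

Definition rcoef (R : realType) n (s : 'I_n) (v : 'rV[R]_n) : R :=
  (if (s.+1 < n)%N then 1 else 2)^-1 * psum s v.

Lemma simple_roots_coord (R : realType) n :
  free (simple_roots R n) /\ forall j v, coord (simple_roots R n) j v = rcoef j v.
Proof.
apply: coord_expand => v; apply/rowP => j; rewrite summxE -[LHS]psum_expand.
apply: eq_bigr => s _; rewrite mxE nth_mktuple simple_root0j /rcoef.
by case: ifP => _; field.
Qed.

Lemma coroot_simple0j (R : realType) n (s j : 'I_n) :
  coroot (simple_root R s) 0 j = (j == s)%:R - (j == s.+1 :> nat)%:R.
Proof.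
rewrite {1}simple_rootE coroot_rt ?lshift_nx // /rt_coroot nx_sigma.
case: ifPn => h; last by rewrite -simple_rootE simple_root0j; move/negPn: h => ->; rewrite mul1r.
rewrite lvec_lshift mxE.
have -> : (j == s.+1 :> nat) = false by have := ltn_ord j; lia.
by rewrite subr0.
Qed.

Lemma simple_coroots_coord (R : realType) n j (v : 'rV[R]_n) :
  coord (simple_coroots R n) j v = psum j v.
Proof.
have [|_ -> //] := @coord_expand R n (simple_coroots R n) (fun j v => psum j v).
move=> {}v; apply/rowP => k; rewrite summxE -[LHS]psum_expand.
by apply: eq_bigr => s _; rewrite mxE nth_mktuple coroot_simple0j.
Qed.

(** In type C the coroot lattice is all of Z^n: the coefficients of an integer vector on the simple
    coroots are its partial sums. *)
Lemma coroot_latticeP (R : realType) n (xi : 'rV[R]_n) :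
  coroot_lattice xi <-> exists z : 'I_n -> int, forall j, xi 0 j = (z j)%:~R.
Proof.
split=> [[k ->]|[z xiz]].
  exists (fun j : 'I_n => \sum_s k s * ((j == s)%:R - (j == s.+1 :> nat)%:R)) => j.
  rewrite summxE rmorph_sum; apply: eq_bigr => s _.
  by rewrite mxE coroot_simple0j rmorphM rmorphB /= !rmorph_nat.
exists (fun s => \sum_(l < n | (l <= s)%N) z l); apply/rowP => j.
rewrite summxE -[LHS]psum_expand; apply: eq_bigr => s _.
rewrite mxE coroot_simple0j; congr (_ * _); rewrite rmorph_sum.
by apply: eq_bigr => l _; rewrite xiz.
Qed.

(* Every positive root is p - q for exactly one pair of letters with hp p q. *)
Definition hp n (a b : letter n) : bool := (a < b)%N && (a + b < n + n)%N.

(** A copy of the local definition [half] inside [roots], named so that [roots] is convertible to an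
    expression in it. *)
Definition hroots (R : realType) n : seq 'rV[R]_n :=
  let pairs := [seq p : 'I_n * 'I_n <- enum {: 'I_n * 'I_n} | (p.1 < p.2)%N] in
  [seq eps R n p.1 + eps R n p.2 | p : 'I_n * 'I_n <- pairs]
           ++ [seq eps R n p.1 - eps R n p.2 | p : 'I_n * 'I_n <- pairs]
           ++ [seq 2 *: eps R n s | s : 'I_n].

Lemma halfP (R : realType) n (g : 'rV[R]_n) :
  (exists a b, hp a b /\ g = rt R a b) <-> g \in hroots R n.
Proof.
rewrite !mem_cat; split=> [[a [b [/andP[ab abn] ->]]]|].
  have an : (a < n)%N by move: ab abn; clear; lia.
  have [s e] := letter_lshift an; subst a; move: abn ab; rewrite /rt lvec_lshift.
  case: (letterP b) => t; rewrite ?sigmaE /= ?lvec_sigma lvec_lshift => abn ab.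
    apply/orP; right; apply/orP; left; apply/mapP; exists (s, t) => //.
    by rewrite mem_filter mem_enum ab.
  rewrite opprK; have [st|] := boolP (s == t).
    apply/orP; right; apply/orP; right; apply/mapP; exists s; first by rewrite mem_enum.
    by rewrite -(eqP st) -mulr2n scaler_nat.
  rewrite -val_eqE /= => st; apply/orP; left; apply/mapP; exists (s, t) => //.
  rewrite mem_filter mem_enum andbT /=.
  by move: st abn; have := ltn_ord s; have := ltn_ord t; clear; lia.
case/or3P => /mapP[].
- move=> [s t]; rewrite mem_filter => /andP[/= st _] ->.
  exists (lshift n s), (sigma (lshift n t)); rewrite /rt lvec_sigma opprK !lvec_lshift.
  by split=> //; rewrite /hp sigmaE /=; move: st (ltn_ord t); clear; lia.
- move=> [s t]; rewrite mem_filter => /andP[/= st _] ->.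
  exists (lshift n s), (lshift n t); rewrite /rt !lvec_lshift.
  by split=> //; rewrite /hp /=; move: st (ltn_ord t); clear; lia.
move=> s _ ->; exists (lshift n s), (sigma (lshift n s)).
rewrite /rt lvec_sigma opprK lvec_lshift -mulr2n scaler_nat.
by split=> //; rewrite /hp sigmaE /=; move: (ltn_ord s); clear; lia.
Qed.

(** The index sums of [(a, b)] and [(sigma b, sigma a)] add up to 4n - 2, so one of them is below
    2n. *)
Lemma hp_or_sigma n (a b : letter n) : (a < b)%N -> hp a b \/ hp (sigma b) (sigma a).
Proof. by rewrite /hp !sigmaE; have := ltn_ord a; have := ltn_ord b; lia. Qed.

Lemma rootsP (R : realType) n (g : 'rV[R]_n) :
  g \in Defs.roots R n <-> exists a b, a != b /\ g = rt R a b.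
Proof.
have -> : Defs.roots R n = undup (hroots R n ++ [seq - g | g <- hroots R n]) by [].
rewrite mem_undup mem_cat; split.
  case/orP => [/halfP[a [b [/andP[ab _] ->]]]|/mapP[h /halfP[a [b [/andP[ab _] ->]] ->]]].
    by exists a, b; split=> //; exact: ord_lt_neq.
  by exists b, a; split; rewrite ?rt_opp // ord_gt_neq.
move=> [a [b [ab ->]]]; have [L|L] : (hp a b \/ hp (sigma b) (sigma a)) \/
    (hp b a \/ hp (sigma a) (sigma b)).
  - by move: ab; rewrite -val_eqE neq_ltn => /orP[] /hp_or_sigma; [left|right].
  - apply/orP; left; apply/halfP.
    by case: L => L; do 2!eexists; split; [exact: L| |exact: L|rewrite rt_sigma].
apply/orP; right; apply/mapP; exists (rt R b a); last by rewrite rt_opp.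
by apply/halfP; case: L => L; do 2!eexists; split; [exact: L| |exact: L|rewrite rt_sigma].
Qed.

Lemma rt_roots (R : realType) n (a b : letter n) : a != b -> rt R a b \in Defs.roots R n.
Proof. by move=> ab; apply/rootsP; exists a, b. Qed.

Lemma rcoef_ge0 (R : realType) n (s : 'I_n) (v : 'rV[R]_n) : (0 <= rcoef s v) = (0 <= psum s v).
Proof. by rewrite /rcoef pmulr_rge0 // invr_gt0; case: ifP. Qed.

Lemma pos_roots_rt (R : realType) n (a b : letter n) : a != b ->
  (rt R a b \in pos_roots R n) = (a < b)%N.
Proof.
move=> ab; rewrite mem_filter rt_roots // andbT.
apply/forallP/idP => [h|altb j]; last first.
  rewrite (simple_roots_coord R n).2 rcoef_ge0 psum_rt //.
  move: altb; rewrite !sigmaE; have := ltn_ord j; have := ltn_ord b; have := ltn_ord a.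
  move: (a : nat) (b : nat) (j : nat) => x y z; clear => an bn jn xy.
  by do 4![case: leqP => ?] => /=; first [exfalso; lia | lra].
rewrite ltnNge leq_eqVlt eq_sym val_eqE (negbTE ab) /=; apply/negP => ba.
(* An index with negative partial sum: [b] itself if it is unbarred, and otherwise [sigma a], since
   then both letters are barred. *)
have : exists2 j, (j < n)%N & ((b <= j < a) || (sigma a <= j < sigma b))%N.
  have := ltn_ord a; have := ltn_ord b; rewrite !sigmaE => bn an.
  have [bl|bl] := ltnP b n; [exists b | exists (n + n - a.+1)%N] => //;
    move: ba bn an bl; clear; lia.
move=> [j jn jh]; have := h (Ordinal jn).
rewrite (simple_roots_coord R n).2 rcoef_ge0 psum_rt //.
have := ltn_ord b; have := ltn_ord a; rewrite !sigmaE in jh *.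
move: ba jn jh; rewrite /=; move: (a : nat) (b : nat) => x y; clear => xy jn jh xn yn.
by do 4![case: leqP => ?] => /= ?; first [exfalso; lia | lra].
Qed.

Lemma pos_rootsP (R : realType) n (g : 'rV[R]_n) :
  g \in pos_roots R n -> exists a b : letter n, (a < b)%N /\ g = rt R a b.
Proof.
move=> h; have /rootsP[a [b [ab e]]] : g \in Defs.roots R n by move: h; rewrite mem_filter => /andP[].
by exists a, b; split=> //; rewrite -(pos_roots_rt R ab) -e.
Qed.

Lemma sum_pos_roots (R : realType) n (F : 'rV[R]_n -> R) :
  \sum_(g <- pos_roots R n) F g =
  \sum_(p : letter n * letter n | hp p.1 p.2) F (rt R p.1 p.2).
Proof.
transitivity (\sum_(g <- [seq rt R p.1 p.2 | p <- enum {: letter n * letter n}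
                                            & hp p.1 p.2]) F g); last first.
  by rewrite big_map big_filter big_enum_cond.
apply: perm_big; apply: uniq_perm.
- by rewrite filter_uniq // undup_uniq.
- rewrite map_inj_in_uniq ?filter_uniq -?enumT ?enum_uniq // => -[a b] [c d].
  rewrite !mem_filter /= => /andP[/andP[ab abn] _] /andP[/andP[cd cdn] _].
  have nab := ord_lt_neq ab.
  move=> /(rt_inj nab)[[-> ->] //|[e1 e2]]; subst c d.
  move: cd cdn; rewrite !sigmaE => cd cdn; congr (_, _); apply: val_inj => /=.
    by move: ab abn cd cdn (ltn_ord a) (ltn_ord b); clear; lia.
  by move: ab abn cd cdn (ltn_ord a) (ltn_ord b); clear; lia.
move=> g; apply/idP/mapP => [/pos_rootsP[a [b [ab ->]]]|].
  case: (hp_or_sigma ab) => h; [exists (a, b)|exists (sigma b, sigma a)] => //;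
    rewrite ?rt_sigma // mem_filter h mem_enum //.
move=> [[a b]]; rewrite mem_filter => /andP[/andP[ab _] _] ->; by rewrite pos_roots_rt //= ord_lt_neq.
Qed.

(** * The length function *)

(* Twice the number of inverted positive roots: a pair p < q of letters stands
   for the root p - q, and each root comes from two pairs, except that the
   long ones come from the single pairs with q = sigma p. *)
Definition vlen n (f : letter n -> letter n) : nat :=
  (\sum_(p : letter n) \sum_(q : letter n) ((p < q) && (f q < f p)) * (q == sigma p).+1)%N.

(** Words act by simple reflections on the left of w, that is on the right of its inverse, where
    they permute the pairs being counted. Reindexing by w exchanges the inversions of w and of its
    inverse, and keeps the weights because w commutes with [sigma]. *)
Lemma vlen_inv n (w : weyl n) : vlen (wfun w^-1%g) = vlen (wfun w).
Proof.
rewrite /vlen exchange_big (reindex_inj (@wfun_inj _ w)); apply: eq_bigr => p _.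
rewrite (reindex_inj (@wfun_inj _ w)); apply: eq_bigr => q _.
by rewrite !wfunV andbC -wfun_sigma (inj_eq (@wfun_inj _ w)) -sigma_eq eq_sym.
Qed.

Lemma vlen_id n (f : letter n -> letter n) : f =1 id -> vlen f = 0%N.
Proof.
move=> e; rewrite /vlen big1 // => p _; rewrite big1 // => q _.
by rewrite !e; case: ltngtP.
Qed.

Lemma sw_adj n (s : 'I_n) (p q : letter n) (a := lshift n s) (b := nx s) :
  (sw a b p < sw a b q)%N =
  ~~ (((p == a) && (q == b)) || ((p == sigma b) && (q == sigma a))) &&
  [|| (p == b) && (q == a), (p == sigma a) && (q == sigma b) | (p < q)%N].
Proof.
have swE c : sw a b c = (if c == s :> nat then s.+1 else
    if c == s.+1 :> nat then s : nat else
    if (c + s.+1 == n + n)%N then (n + n - s.+2)%N else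
    if (c + s.+2 == n + n)%N then (n + n - s.+1)%N else c) :> nat.
  rewrite /sw -!val_eqE /=.
  have := ltn_ord c; have := ltn_ord s; clear.
  by do !case: ifP => /= ?; lia.
rewrite !swE -!val_eqE /=; have := ltn_ord p; have := ltn_ord q; have := ltn_ord s.
move: (p : nat) (q : nat) (s : nat) => x y z; clear.
by do !case: ifP; lia.
Qed.

(** An adjacent swap reverses only the pairs [(a, b)] and [(sigma b, sigma a)]. For a short simple
    root they differ and have weight one each; for the long one they coincide and have weight
    two. *)
Lemma vlen_adj n (f : letter n -> letter n) (s : 'I_n) (a := lshift n s) (b := nx s) :
  (forall c, f (sigma c) = sigma (f c)) -> (f a < f b)%N ->
  vlen (f \o sw a b) = (vlen f).+2.
Proof.
move=> fs fab; have swI : injective (sw a b) := can_inj (@swK n a b).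
have pw (p q : letter n) :
  (((sw a b p < sw a b q) && (f q < f p)) * (q == sigma p).+1 =
   ((p < q) && (f q < f p)) * (q == sigma p).+1
   + ((p == b) && (q == a) + (p == sigma a) && (q == sigma b)))%N.
  have g1 : (p == b) && (q == a) ==> (f q < f p)%N.
    by apply/implyP => /andP[/eqP-> /eqP->].
  have g2 : (p == sigma a) && (q == sigma b) ==> (f q < f p)%N.
    by apply/implyP => /andP[/eqP-> /eqP->]; rewrite !fs ltn_sigma.
  have g3 : (p == a) && (q == b) ==> ~~ (f q < f p)%N.
    by apply/implyP => /andP[/eqP-> /eqP->]; rewrite -leqNgt ltnW.
  have g4 : (p == sigma b) && (q == sigma a) ==> ~~ (f q < f p)%N.
    by apply/implyP => /andP[/eqP-> /eqP->]; rewrite !fs -leqNgt ltnW // ltn_sigma.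
  have h1 : (p == b) && (q == a) ==> [&& ~~ (p < q)%N, ~~ ((p == a) && (q == b)),
       ~~ ((p == sigma b) && (q == sigma a)) &
       (p == sigma a) && (q == sigma b) == (q == sigma p)].
    apply/implyP; rewrite -!val_eqE /=; have := ltn_ord s.
    by move: (p : nat) (q : nat) (s : nat) => x y z; clear; lia.
  have h2 : (p == sigma a) && (q == sigma b) ==> [&& ~~ (p < q)%N, ~~ ((p == a) && (q == b)),
       ~~ ((p == sigma b) && (q == sigma a)) &
       (p == b) && (q == a) == (q == sigma p)].
    apply/implyP; rewrite -!val_eqE /=; have := ltn_ord s.
    by move: (p : nat) (q : nat) (s : nat) => x y z; clear; lia.
  rewrite sw_adj -/a -/b; move: g1 g2 g3 g4 h1 h2; clear.
  case: (f q < f p)%N; case: (p < q)%N; case: ((p == b) && _); case: ((p == sigma a) && _);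
  by case: ((p == a) && _); case: ((p == sigma b) && _); case: (q == sigma p).
rewrite /vlen (reindex_inj swI).
transitivity (\sum_(p : letter n) \sum_(q : letter n)
   ((sw a b p < sw a b q) && (f q < f p)) * (q == sigma p).+1)%N.
  apply: eq_bigr => p _; rewrite (reindex_inj swI); apply: eq_bigr => q _.
  by rewrite /= !swK -sw_sigma (inj_eq swI).
have one (c d : letter n) : (\sum_(p : letter n) \sum_(q : letter n) ((p == c) && (q == d)) = 1)%N.
  rewrite (bigD1 c) //= [X in (_ + X)%N]big1 => [|p pc]; last first.
    by rewrite big1 // => q _; rewrite (negbTE pc).
  rewrite addn0 (bigD1 d) //= [X in (_ + X)%N]big1 ?eqxx // => q qd.
  by rewrite (negbTE qd) andbF.
under eq_bigr => p _ do under eq_bigr => q _ do rewrite pw.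
under eq_bigr => p _ do rewrite big_split big_split /=.
by rewrite big_split big_split /= !one addn2.
Qed.

Lemma letter_adj n (k : nat) (h : (k.+1 < n + n)%N) (hk := ltnW h) :
  (exists s : 'I_n, lshift n s = Ordinal hk /\ nx s = Ordinal h) \/
  (exists s : 'I_n, sigma (nx s) = Ordinal hk /\ sigma (lshift n s) = Ordinal h).
Proof.
have [kn|nk] := ltnP k n; first by left; exists (Ordinal kn); split; apply: val_inj.
have h' : (n + n - k.+2 < n)%N by have := h; move: nk; clear; lia.
by right; exists (Ordinal h'); split; apply: val_inj; rewrite /=; have := h; move: nk; clear; lia.
Qed.

(** The symmetry under [sigma] extends the hypothesis to all consecutive letters, so [a <= f a] by
    induction; applied to [sigma a] this gives the reverse inequality. *)
Lemma adj_mono_id n (f : letter n -> letter n) :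
  (forall c, f (sigma c) = sigma (f c)) ->
  (forall s, (f (lshift n s) < f (nx s))%N) -> f =1 id.
Proof.
move=> fs fm; have le (a : letter n) : (a <= f a)%N.
  case: a => k; elim: k => [//|k IH] h; have := IH (ltnW h) => {IH}.
  have : (f (Ordinal (ltnW h)) < f (Ordinal h))%N; last by move=> h1 h2; exact: leq_ltn_trans h2 h1.
  by have [[s [<- <-]]|[s [<- <-]]] := letter_adj h; rewrite ?fs ?ltn_sigma fm.
move=> a; apply: val_inj; apply/eqP; rewrite eqn_leq le andbT /=.
by rewrite leqNgt -ltn_sigma -fs -leqNgt le.
Qed.

Lemma wfun_comp_inv n (w : weyl n) (a b : letter n) :
  wfun (wcomp (wsw a b) w)^-1%g =1 wfun w^-1%g \o sw a b.
Proof.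
move=> c; rewrite /= -[RHS](wfunV (wcomp (wsw a b) w)).
by rewrite wfun_comp wfunKV wfun_wsw swK.
Qed.

Lemma eq_vlen n (f g : letter n -> letter n) : f =1 g -> vlen f = vlen g.
Proof. by move=> e; apply: eq_bigr => p _; apply: eq_bigr => q _; rewrite !e. Qed.

Lemma wrefl_simple (R : realType) n (s : 'I_n) :
  wrefl (simple_root R s) = wsw (lshift n s) (nx s).
Proof. by rewrite simple_rootE wrefl_rt // lshift_nx. Qed.

Lemma vlen_simple (R : realType) n (w : weyl n) (s : 'I_n) (f := wfun w^-1%g)
    (f' := wfun (wcomp (wrefl (simple_root R s)) w)^-1%g) :
  if (f (lshift n s) < f (nx s))%N then vlen f' = (vlen f).+2 else vlen f = (vlen f').+2.
Proof.
rewrite {}/f' wrefl_simple (eq_vlen (wfun_comp_inv _ _ _)).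
case: ltnP => h; first by rewrite vlen_adj // => c; rewrite wfun_sigma.
rewrite [in LHS](@eq_vlen _ f ((f \o sw (lshift n s) (nx s)) \o sw (lshift n s) (nx s))).
  rewrite vlen_adj // => [c|]; first by rewrite /= sw_sigma /f wfun_sigma.
  rewrite /= swl swr ltn_neqAle h andbT val_eqE (inj_eq (@wfun_inj _ _)) eq_sym.
  exact: lshift_nx.
by move=> c; rewrite /= swK.
Qed.

Lemma word_vlen (R : realType) n (s : seq 'I_n) :
  (vlen (wfun (word R s)^-1%g) <= 2 * size s)%N.
Proof.
elim: s => [|j s IH] /=; first by rewrite vlen_id // => a; rewrite invg1 wfun1.
by have := vlen_simple R (word R s) j => /=; case: ltnP => _; rewrite mulnS; move: IH; lia.
Qed.

(** Descent on [vlen]: if the inverse of w increases along every simple pair, w is trivial;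
    otherwise a simple reflection on the left lowers the count by 2 and supplies a letter of the
    word. *)
Lemma vlen_word (R : realType) n (w : weyl n) :
  exists s, word R s = w /\ vlen (wfun w^-1%g) = (2 * size s)%N.
Proof.
have [m] := ubnP (vlen (wfun w^-1%g)); elim: m w => // m IH w hw.
have [/forallP h|] := boolP [forall s, wfun w^-1%g (lshift n s) < wfun w^-1%g (nx s)]%N.
  have e : wfun w^-1%g =1 id by apply: adj_mono_id => // c; rewrite wfun_sigma.
  exists [::]; rewrite vlen_id //; split=> //=.
  by apply: weylP => a; rewrite wfun1 -[in RHS](e a) wfunKV.
rewrite negb_forall => /existsP[j]; rewrite -leqNgt => hj.
have := vlen_simple R w j; rewrite /= ltnNge hj /= => e.
have [|s [ws es]] := IH (wcomp (wrefl (simple_root R j)) w).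
  by move: hw; rewrite e; lia.
exists (j :: s); split; last by rewrite /= mulnS -es e.
rewrite /= ws wrefl_simple; apply: weylP => a.
by rewrite !wfun_comp !wfun_wsw swK.
Qed.

Lemma wlengthE (R : realType) n (w : weyl n) : (2 * wlength R w = vlen (wfun w))%N.
Proof.
rewrite -vlen_inv; have [s [ws es]] := vlen_word R w.
have hs : has_word R w (size s).
  by apply/existsP; exists (in_tuple s); rewrite /= ws.
rewrite /wlength; case: pselect => [h|]; last by case; exists (size s).
case: ex_minnP => k /existsP[t /eqP tw] kmin.
have ks := kmin _ hs; have := word_vlen R t; rewrite tw size_tuple es.
by move: ks; lia.
Qed.

(** * The set (W^J)_af *)

(* The pairing of xi with the root vector of a letter; so zl (sigma a) = - zl a. *)
Definition zl (R : realType) n (xi : 'rV[R]_n) (a : letter n) : int :=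
  Num.floor (dot xi (lvec R a)).

Definition integral (R : realType) n (xi : 'rV[R]_n) : Prop :=
  forall j, xi 0 j \is a Num.int.

Lemma coroot_lattice_int (R : realType) n (xi : 'rV[R]_n) :
  coroot_lattice xi <-> integral xi.
Proof.
rewrite coroot_latticeP; split=> [[z h] j|h]; first by rewrite h intr_int.
by exists (fun j => Num.floor (xi 0 j)) => j; rewrite floorK.
Qed.

Lemma zlE (R : realType) n (xi : 'rV[R]_n) (a : letter n) : integral xi ->
  (zl xi a)%:~R = dot xi (lvec R a).
Proof.
move=> h; rewrite /zl floorK //.
by case: (letterP a) => s; rewrite ?lvec_sigma ?dotNr ?rpredN lvec_lshift dot_eps.
Qed.

Lemma zl_sigma (R : realType) n (xi : 'rV[R]_n) (a : letter n) : integral xi ->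
  zl xi (sigma a) = - zl xi a.
Proof.
move=> h; apply: (@intr_inj R).
by rewrite rmorphN /= !zlE // lvec_sigma dotNr.
Qed.

(* 0, 1, 2 for a among the first i letters, the middle ones, the last i ones;
   the roots of Delta_J, J = I \ {i}, are the differences within a block. *)
Definition blk n (i : 'I_n) (a : letter n) : nat := ((i < a) + (sigma a <= i))%N.

Lemma psum_rt_eq0 (R : realType) n (i : 'I_n) (a b : letter n) :
  (psum i (rt R a b) == 0) = (blk i a == blk i b).
Proof.
rewrite psum_rt // /blk !sigmaE.
have := ltn_ord a; have := ltn_ord b; have := ltn_ord i.
move: (a : nat) (b : nat) (i : nat) => x y z; clear => zn yn xn.
case: (leqP x z) => ?; case: (leqP y z) => ?;
 case: (leqP (n + n - x.+1) z) => ?; case: (leqP (n + n - y.+1) z) => ? /=;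
 rewrite /= ?(addn0, add0n) ?eqxx /=;
 first [exfalso; lia | by apply/eqP; lra | by apply/negbTE/eqP => ?; lra].
Qed.

Lemma simple_roots_expand (R : realType) n (v : 'rV[R]_n) :
  v = \sum_s rcoef s v *: simple_root R s.
Proof.
apply/rowP => j; rewrite summxE -[LHS]psum_expand.
apply: eq_bigr => s _; rewrite mxE simple_root0j /rcoef.
by case: ifP => _; field.
Qed.

(** Only the last coefficient is halved, and the sum of all coordinates of a root is 0, 2 or -2. *)
Lemma rcoef_int (R : realType) n (s : 'I_n) (a b : letter n) :
  rcoef s (rt R a b) \is a Num.int.
Proof.
rewrite /rcoef psum_rt //; case: ifP => h.
  by rewrite invr1 mul1r !rpredB // ?natr_int.
have se : s = n.-1 :> nat by have := ltn_ord s; lia.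
rewrite !sigmaE se; have := ltn_ord a; have := ltn_ord b; have := ltn_ord s.
move: (a : nat) (b : nat) => x y; clear => nn yn xn.
case: (leqP x n.-1) => ?; case: (leqP y n.-1) => ?;
 case: (leqP (n + n - x.+1) n.-1) => ?; case: (leqP (n + n - y.+1) n.-1) => ? /=;
 try (exfalso; lia).
- by rewrite [X in X \is a _](_ : _ = 0); [exact: rpred0 | lra].
- by rewrite [X in X \is a _](_ : _ = 1); [exact: rpred1 | lra].
- by rewrite [X in X \is a _](_ : _ = -1); [rewrite rpredN rpred1 | lra].
- by rewrite [X in X \is a _](_ : _ = 0); [exact: rpred0 | lra].
Qed.

Lemma root_subP (R : realType) n (i : 'I_n) (a b : letter n) : a != b ->
  in_root_sub [set~ i] (rt R a b) <-> blk i a = blk i b.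
Proof.
move=> ab; split=> [[_ [k e]]|h].
  apply/eqP; rewrite -(psum_rt_eq0 R) -(mulrI_eq0 _ (@mulfI _ (if (i.+1 < n)%N then 1 else 2)^-1 _)).
    rewrite -/(rcoef i _) -(simple_roots_coord R n).2 {1}e.
    rewrite (_ : \sum_(j in _) _ = \sum_j (if j != i then (k j)%:~R else 0) *: (simple_roots R n)`_j).
      by rewrite coord_sum_free ?eqxx //; exact: (simple_roots_coord R n).1.
    rewrite big_mkcond; apply: eq_bigr => j _; rewrite in_setC1 nth_mktuple.
    by case: ifP => //; rewrite scale0r.
  by case: ifP => _; rewrite invr_eq0 ?oner_neq0 ?pnatr_eq0.
split; first exact: rt_roots.
exists (fun s => Num.floor (rcoef s (rt R a b))).
rewrite {1}[rt R a b]simple_roots_expand [RHS]big_mkcond; apply: eq_bigr => s _.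
rewrite in_setC1 floorK ?rcoef_int //; case: eqVneq => //= ->.
by move/eqP: h; rewrite -(psum_rt_eq0 R) /rcoef => /eqP ->; rewrite mulr0 scale0r.
Qed.

Lemma pos_aff_rt (R : realType) n (a b : letter n) (m : int) : a != b ->
  pos_aff_root (rt R a b, m%:~R) <-> 0 < m \/ (m = 0 /\ (a < b)%N).
Proof.
move=> ab; split=> [[/=[]|/=[]]|].
- by rewrite pos_roots_rt // => h /(@intr_inj R _ 0) ->; right.
- by move=> _ [k k0 /intr_inj ->]; left.
case=> [h|[-> h]]; [right|left]; rewrite /= ?rt_roots ?pos_roots_rt //.
by split=> //; exists m.
Qed.

(* With kappa a := w a + 2n * zl a, this says kappa a < kappa b < kappa a + 2n. *)
Definition okp (R : realType) n (x : waf R n) (a b : letter n) : Prop :=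
  (zl x.2 b = zl x.2 a /\ (wfun x.1 a < wfun x.1 b)%N)
  \/ (zl x.2 b = zl x.2 a + 1 /\ (wfun x.1 b < wfun x.1 a)%N).

Lemma waf_act_rt (R : realType) n (x : waf R n) a b (m : int) : integral x.2 ->
  waf_act x (rt R a b, m%:~R) =
    (rt R (wfun x.1 a) (wfun x.1 b), (m + (zl x.2 b - zl x.2 a))%:~R).
Proof.
move=> h; rewrite /waf_act /= wact_rt; congr (_, _).
by rewrite /rt dotBr rmorphD rmorphB /= !zlE // opprB.
Qed.

(** It suffices to test [a - b] and [b - a + delta]: the first gives the lower bound on kappa, the
    second the upper one, and further multiples of delta follow. *)
Lemma WJafP (R : realType) n (i : 'I_n) (x : waf R n) :
  in_WJaf [set~ i] x <->
  integral x.2 /\ forall a b : letter n, (a < b)%N -> blk i a = blk i b -> okp x a b.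
Proof.
have wneq a b : a != b -> wfun x.1 a != wfun x.1 b by rewrite (inj_eq (@wfun_inj _ _)).
split=> [[/coroot_lattice_int xi h]|[xi h]].
  split=> // a b ab e; have nab := ord_lt_neq ab; have nba := ord_gt_neq ab.
  have h1 : pos_aff_root (waf_act x (rt R a b, 0%:~R)).
    by apply: h; [apply/pos_aff_rt => //; right | apply/root_subP].
  have h2 : pos_aff_root (waf_act x (rt R b a, 1%:~R)).
    by apply: h; [apply/pos_aff_rt => //; left | apply/root_subP].
  move: h1 h2; rewrite !waf_act_rt // !pos_aff_rt ?wneq // /okp.
  move: (zl _ _) (zl _ _) (wfun _ _ : nat) (wfun _ _ : nat) => u v y z; clear; lia.
split; first exact/coroot_lattice_int.
have key (a b : letter n) (m : int) : a != b -> blk i a = blk i b -> 0 < m \/ (m = 0 /\ (a < b)%N) ->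
    pos_aff_root (waf_act x (rt R a b, m%:~R)).
  move=> ab e hm; rewrite waf_act_rt // pos_aff_rt ?wneq //.
  have [l|l] := ord_neq_lt ab.
    have := h _ _ l e; move: hm l; rewrite /okp.
    move: (zl _ _) (zl _ _) (wfun _ _ : nat) (wfun _ _ : nat) => u v y z; clear; lia.
  have := h _ _ l (esym e); move: hm l; rewrite /okp.
  move: (zl _ _) (zl _ _) (wfun _ _ : nat) (wfun _ _ : nat) => u v y z; clear; lia.
move=> [g m] [/= [gp ->]|/= [gr [k k0 ->]]] /=.
  have [a [b [ab ->]]] := pos_rootsP gp; have nab := ord_lt_neq ab.
  by move/(root_subP R i nab) => e; apply: (key a b 0) => //; right.
have [a [b [ab ->]]] := (rootsP g).1 gr.
by move/(root_subP R i ab) => e; apply: (key a b k) => //; left.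
Qed.

(** * The semi-infinite length on (W^J)_af *)

Definition mid n (i : 'I_n) (a : letter n) : bool := (i < a)%N && (i < sigma a)%N.

Lemma mid_sigma n (i : 'I_n) (a : letter n) : mid i (sigma a) = mid i a.
Proof. by rewrite /mid sigmaK andbC. Qed.

Lemma blk_lt n (i : 'I_n) (a b : letter n) : (blk i a < blk i b)%N -> (a < b)%N.
Proof.
rewrite /blk !sigmaE; have := ltn_ord a; have := ltn_ord b.
by move: (a : nat) (b : nat) (i : nat) => x y z; clear; lia.
Qed.

Lemma blk_le n (i : 'I_n) (a b : letter n) : (a < b)%N -> (blk i a <= blk i b)%N.
Proof.
rewrite /blk !sigmaE; have := ltn_ord a; have := ltn_ord b.
by move: (a : nat) (b : nat) (i : nat) => x y z; clear; lia.
Qed.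

Lemma blk_lo n (i : 'I_n) (a b : letter n) : (a <= i)%N -> (b <= i)%N -> blk i a = blk i b.
Proof.
rewrite /blk !sigmaE; have := ltn_ord i.
by move: (a : nat) (b : nat) (i : nat) => x y z; clear; lia.
Qed.

Lemma blk_mid n (i : 'I_n) (a b : letter n) : mid i a -> mid i b -> blk i a = blk i b.
Proof. by rewrite /mid /blk => /andP[-> h] /andP[-> h']; move: h h'; lia. Qed.

(** The block can increase in three ways: first to middle, middle to last, first to last. The
    involution [sigma] then replaces the last block by the first in each sum. *)
Lemma sum_blk n (i : 'I_n) (H : letter n -> letter n -> int) :
  \sum_(p : letter n) \sum_(q : letter n) (if (blk i p < blk i q)%N then H p q else 0) =
  \sum_(p : letter n | (p <= i)%N) \sum_(q : letter n | mid i q) H p q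
  + \sum_(p : letter n | (p <= i)%N) \sum_(q : letter n | mid i q) H (sigma q) (sigma p)
  + \sum_(p : letter n | (p <= i)%N) \sum_(q : letter n | (q <= i)%N) H p (sigma q).
Proof.
have sI := can_inj (@sigmaK n).
transitivity (\sum_(p : letter n) \sum_(q : letter n) (
   (if (p <= i)%N then if mid i q then H p q else 0 else 0) +
   (if mid i p then if (sigma q <= i)%N then H p q else 0 else 0) +
   (if (p <= i)%N then if (sigma q <= i)%N then H p q else 0 else 0))).
  apply: eq_bigr => p _; apply: eq_bigr => q _.
  rewrite /blk /mid; have := ltn_ord p; have := ltn_ord q; have := ltn_ord i; rewrite !sigmaE.
  move: (p : nat) (q : nat) (i : nat) (H p q) => x y z h; clear.
  case: (leqP x z) => ?; case: (leqP y z) => ?;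
  case: (leqP (n + n - x.+1) z) => ?; case: (leqP (n + n - y.+1) z) => ? /=;
  lia.
under eq_bigr => p _ do rewrite 2!big_split /=.
rewrite 2!big_split /=; congr (_ + _).
  congr (_ + _).
    rewrite [RHS]big_mkcond; apply: eq_bigr => p _.
    case: ifP => _; last by rewrite big1.
    by rewrite [RHS]big_mkcond.
  rewrite [RHS]exchange_big [RHS]big_mkcond [RHS](reindex_inj sI) /=; apply: eq_bigr => p _.
  rewrite mid_sigma; case: ifP => _; last by rewrite big1.
  rewrite [RHS]big_mkcond [RHS](reindex_inj sI).
  by apply: eq_bigr => q _; rewrite !sigmaK.
rewrite [RHS]big_mkcond; apply: eq_bigr => p _.
case: ifP => _; last by rewrite big1.
rewrite [RHS]big_mkcond [RHS](reindex_inj sI).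
by apply: eq_bigr => q _; rewrite !sigmaK.
Qed.

Lemma sum_hp n (F : letter n -> letter n -> int) :
  (forall p q, F (sigma q) (sigma p) = F p q) ->
  \sum_(p : letter n) \sum_(q : letter n) (p < q)%N%:R * (q == sigma p).+1%:R * F p q
  = 2 * \sum_(p : letter n * letter n | hp p.1 p.2) F p.1 p.2.
Proof.
have sI := can_inj (@sigmaK n).
move=> Fs; have -> : \sum_(p : letter n * letter n | hp p.1 p.2) F p.1 p.2 =
    \sum_(p : letter n) \sum_(q : letter n) (if hp p q then F p q else 0).
  by rewrite pair_bigA /= [LHS]big_mkcond.
rewrite [2%:R]mulr2n mulrDl mul1r [X in _ = _ + X]exchange_big [X in _ = _ + X](reindex_inj sI) /=.
rewrite -big_split; apply: eq_bigr => p _ /=.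
rewrite [X in _ + X](reindex_inj sI) /= -big_split; apply: eq_bigr => q _ /=.
rewrite Fs /hp -!val_eqE !sigmaE /=; have := ltn_ord p; have := ltn_ord q.
move: (p : nat) (q : nat) (F p q) => x y h; clear => yn xn.
case: (ltnP x y) => l /=; last by rewrite !mul0r; case: ifP; lia.
rewrite mul1r; case: (eqVneq y (n + n - x.+1)%N) => e;
  do 2!case: ifP => /= ?; rewrite ?mul1r; lia.
Qed.

Lemma sum_lt n (a : letter n) : \sum_(q : letter n) (q < a)%N%:R = a%:R :> int.
Proof.
rewrite -natr_sum; congr (_%:R).
transitivity (\sum_(q : letter n | (q < a)%N) 1)%N.
  by rewrite [RHS]big_mkcond; apply: eq_bigr => q _; case: ifP.
by rewrite -(big_ord_widen (n + n) (fun=> 1%N)) ?sum1_card ?card_ord // ltnW.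
Qed.

Lemma card_lo n (i : 'I_n) : \sum_(q : letter n | (q <= i)%N) 1 = (i.+1)%:R :> int.
Proof.
transitivity ((\sum_(q : letter n | (q < i.+1)%N) 1)%N%:R : int); first by rewrite natr_sum.
by rewrite -(big_ord_widen (n + n) (fun=> 1%N)) ?sum1_card ?card_ord // ltn_addr.
Qed.

Lemma sum_mid n (i : 'I_n) (F : letter n -> int) :
  \sum_(q : letter n | mid i q) F q =
  \sum_(q : letter n) F q - \sum_(q : letter n | (q <= i)%N) (F q + F (sigma q)).
Proof.
have sI := can_inj (@sigmaK n).
rewrite big_split /= [X in _ - (_ + X)](reindex_inj sI) /=.
under [X in _ - (_ + X)]eq_bigr => q _ do rewrite sigmaK.
rewrite [LHS]big_mkcond [X in _ - (X + _)]big_mkcond [X in _ - (_ + X)]big_mkcond.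
rewrite -big_split -sumrB; apply: eq_bigr => q _ /=.
rewrite /mid !sigmaE; have := ltn_ord q; have := ltn_ord i.
move: (q : nat) (i : nat) (F q) => x y h; clear => yn xn.
by do 3!case: ifP => /= ?; lia.
Qed.

Definition cc (R : realType) n (i : 'I_n) (xi : 'rV[R]_n) : int :=
  \sum_(p : letter n | (p <= i)%N) zl xi p.

(* Up to a constant, twice the length of the minimal representative: among the
   pairs of letters p, q of a tableau those with p + q < 0 lower the count. *)
Definition stat n (i : 'I_n) (f : letter n -> letter n) : int :=
  2 * (\sum_(p : letter n | (p <= i)%N) (f p)%:R) -
  \sum_(p : letter n | (p <= i)%N) \sum_(q : letter n | (q <= i)%N)
    (p != q)%:R * (sigma (f q) < f p)%N%:R.

(** A middle letter [b] and [sigma b] lie in one block, so [zl (sigma b) - zl b = -2 zl b] is 0 or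
    1, and parity leaves 0. *)
Lemma zl_mid (R : realType) n (i : 'I_n) (x : waf R n) (a : letter n) :
  in_WJaf [set~ i] x -> mid i a -> zl x.2 a = 0.
Proof.
move=> /WJafP[xi h].
have H (b : letter n) : (b < n)%N -> mid i b -> zl x.2 b = 0.
  move=> bn bm; have bs : (b < sigma b)%N by rewrite sigmaE; move: bn; lia.
  have := h _ _ bs (blk_mid bm (etrans (mid_sigma i b) bm)).
  rewrite /okp zl_sigma // wfun_sigma; move: (zl _ _) => u; lia.
move=> am; have [an|na] := ltnP a n; first exact: H.
have := H (sigma a); rewrite sigma_ltn mid_sigma zl_sigma // => /(_ na am) e.
by rewrite -[LHS]opprK e oppr0.
Qed.

(* The sum of [w g < 0] + <xi, g> over the positive roots g; it vanishes termwise
   on the roots of Delta_J by the definition of (W^J)_af. *)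
Lemma si_lengthE (R : realType) n (i : 'I_n) (x : waf R n) : in_WJaf [set~ i] x ->
  2 * si_length x = (stat i (wfun x.1) + 2 * (n + n - i)%:R * cc i x.2
    - \sum_(p : letter n | (p <= i)%N) \sum_(q : letter n | (q <= i)%N) (p != q)%:R)%:~R.
Proof.
move=> xW; have [xi xok] := (WJafP i x).1 xW.
pose G (p q : letter n) : int := (wfun x.1 q < wfun x.1 p)%N%:R + (zl x.2 p - zl x.2 q).
have Gs p q : G (sigma q) (sigma p) = G p q.
  by rewrite /G !wfun_sigma ltn_sigma !zl_sigma //; ring.
have -> : 2 * si_length x =
    (\sum_(p : letter n) \sum_(q : letter n) (p < q)%N%:R * (q == sigma p).+1%:R * G p q)%:~R.
  have -> : 2 * si_length x = (vlen (wfun x.1))%:R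
      + 2 * \sum_(g <- pos_roots R n) dot x.2 g.
    have e : 2 * dot x.2 (rho R n) = \sum_(g <- pos_roots R n) dot x.2 g.
      by rewrite /rho dotZr dot_sumr mulrA divff ?pnatr_eq0 // mul1r.
    by rewrite /si_length e mulrDr -natrM wlengthE.
  rewrite sum_pos_roots.
  have -> : \sum_(p : letter n * letter n | hp p.1 p.2) dot x.2 (rt R p.1 p.2) =
      (\sum_(p : letter n * letter n | hp p.1 p.2) (zl x.2 p.1 - zl x.2 p.2))%:~R.
    rewrite rmorph_sum; apply: eq_bigr => p _.
    by rewrite rmorphB /= !zlE // /rt dotBr.
  have -> : (vlen (wfun x.1))%:R = (vlen (wfun x.1))%:R%:~R :> R by rewrite rmorph_nat.
  rewrite -[2%:R](@rmorph_nat _ _ (@intmul R 1)) -rmorphM -rmorphD /=; congr (_%:~R).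
  rewrite -(@sum_hp _ (fun p q => zl x.2 p - zl x.2 q)); last first.
    by move=> p q; rewrite !zl_sigma //; ring.
  rewrite /vlen natr_sum -big_split; apply: eq_bigr => p _ /=.
  rewrite natr_sum -big_split; apply: eq_bigr => q _ /=.
  rewrite /G [RHS]mulrDr; congr (_ + _); rewrite natrM.
  by case: (p < q)%N; rewrite /= ?mul1r ?mul0r // mulrC.
congr (_%:~R).
set i1 : int := i.+1%:R.
pose S1 p : int := \sum_(q : letter n | (q <= i)%N) (wfun x.1 q < wfun x.1 p)%N%:R.
pose S2 p : int := \sum_(q : letter n | (q <= i)%N) (sigma (wfun x.1 q) < wfun x.1 p)%N%:R.
have cst z : \sum_(p : letter n | (p <= i)%N) z = i1 * z.
  by rewrite -[i1]card_lo mulr_suml; apply: eq_bigr => p _; rewrite mul1r.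
have sumw (p : letter n) : \sum_(q : letter n) (wfun x.1 q < wfun x.1 p)%N%:R = (wfun x.1 p)%:R :> int.
  by rewrite -[RHS]sum_lt [RHS](reindex_inj (@wfun_inj _ x.1)).
have M p : \sum_(q : letter n | mid i q) G p q =
    (wfun x.1 p)%:R - S1 p - S2 p + ((n + n)%:R - 2 * i1) * zl x.2 p.
  rewrite (eq_bigr (fun q => (wfun x.1 q < wfun x.1 p)%N%:R + zl x.2 p)); last first.
    by move=> q qm; rewrite /G (zl_mid xW qm) subr0.
  rewrite big_split /= !sum_mid sumr_const card_ord big_split /= cst.
  rewrite sumw.
  under [X in _ - (_ + X)]eq_bigr => q _ do rewrite wfun_sigma.
  rewrite -/(S1 p) -/(S2 p) -mulr_natl; ring.
(* For [p != q] exactly one of the two comparisons holds, so the sum of [S1] does not depend on w;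
   it becomes the constant of the formula. *)
have S1sum : 2 * \sum_(p : letter n | (p <= i)%N) S1 p =
    \sum_(p : letter n | (p <= i)%N) \sum_(q : letter n | (q <= i)%N) (p != q)%:R.
  rewrite [2%:R]mulr2n mulrDl mul1r [X in _ + X]exchange_big -big_split /=.
  apply: eq_bigr => p _; rewrite -big_split /=; apply: eq_bigr => q _.
  by rewrite -(inj_eq (@wfun_inj _ x.1)) -val_eqE neq_ltn; case: ltngtP.
rewrite (eq_bigr (fun p => \sum_(q : letter n)
    if (blk i p < blk i q)%N then (q == sigma p).+1%:R * G p q else 0)); last first.
  move=> p _; apply: eq_bigr => q _; case: (ltnP p q) => l; last first.
    by rewrite !mul0r; case: ifP => // /blk_lt; rewrite ltnNge l.
  rewrite mul1r; case: ifP => // h.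
  have e : blk i p = blk i q by apply/eqP; rewrite eqn_leq blk_le // leqNgt h.
  have := xok _ _ l e; rewrite /okp /G => -[[-> h1]|[-> h1]].
    by rewrite ltnNge ltnW //= subrr addr0 mulr0.
  by rewrite h1 /=; ring.
rewrite sum_blk.
rewrite [X in X + _ + _](eq_bigr (fun p => \sum_(q : letter n | mid i q) G p q)); last first.
  move=> p pl; apply: eq_bigr => q /andP[_ qm].
  by rewrite (negbTE (_ : q != sigma p)) ?mul1r // -sigma_eq; apply: contraL qm => /eqP ->; rewrite -ltnNge.
rewrite [X in _ + X + _](eq_bigr (fun p => \sum_(q : letter n | mid i q) G p q)); last first.
  move=> p pl; apply: eq_bigr => q /andP[_ qm].
  by rewrite Gs sigmaK (negbTE (_ : sigma p != q)) ?mul1r // sigma_eq; apply: contraL qm => /eqP <-; rewrite -ltnNge.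
rewrite -!big_split /=.
(* The coefficient of [zl x.2 p]: each of the two sums against the middle block gives [2n - 2 * i1],
   and the sum against the last block gives [i1 + 2]. Together with the [i1] copies of [cc] this
   makes [4n - 2 * i1 + 2 = 2 * (2n - i)]. *)
rewrite (eq_bigr (fun p => 2 * (wfun x.1 p)%:R -
   \sum_(q : letter n | (q <= i)%N) (p != q)%:R * (sigma (wfun x.1 q) < wfun x.1 p)%N%:R
   + (4 * n%:R - 3 * i1 + 2) * zl x.2 p + cc i x.2 - 2 * S1 p)); last first.
  move=> p pl; rewrite M.
  have pick (F : letter n -> int) : \sum_(q : letter n | (q <= i)%N) (q == p)%:R * F q = F p.
    rewrite (bigD1 p) //= eqxx mul1r big1 ?addr0 // => q /andP[_ /negbTE ->].
    by rewrite mul0r.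
  have -> : \sum_(q : letter n | (q <= i)%N) (sigma q == sigma p).+1%:R * G p (sigma q) =
    S2 p + i1 * zl x.2 p + cc i x.2 + ((sigma (wfun x.1 p) < wfun x.1 p)%N%:R + 2 * zl x.2 p).
    rewrite (eq_bigr (fun q => ((sigma (wfun x.1 q) < wfun x.1 p)%N%:R + zl x.2 p + zl x.2 q) +
      (q == p)%:R * ((sigma (wfun x.1 q) < wfun x.1 p)%N%:R + zl x.2 p + zl x.2 q))); last first.
      move=> q _; rewrite (inj_eq (can_inj (@sigmaK n))) /G wfun_sigma zl_sigma // opprK -natr1; ring.
    by rewrite big_split /= !pick !big_split /= cst; rewrite /cc /S2; ring.
  have -> : \sum_(q : letter n | (q <= i)%N) (p != q)%:R * (sigma (wfun x.1 q) < wfun x.1 p)%N%:R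
     = S2 p - (sigma (wfun x.1 p) < wfun x.1 p)%N%:R.
    rewrite -(pick (fun q => (sigma (wfun x.1 q) < wfun x.1 p)%N%:R)) -sumrB.
    apply: eq_bigr => q _; rewrite [q == p]eq_sym.
    by case: eqVneq => _ /=; rewrite ?mul1r ?mul0r ?subr0 ?subrr.
  rewrite natrD; ring.
rewrite sumrB -[\sum_(_ | _) 2 * S1 _]mulr_sumr S1sum; congr (_ - _).
rewrite big_split /= cst big_split /= -[\sum_(_ | _) _ * zl _ _]mulr_sumr -/(cc i x.2).
rewrite sumrB -mulr_sumr -/(stat _ _) -addrA; congr (_ + _).
rewrite -mulrDl; congr (_ * _); rewrite /i1 natrB ?natrD ?natrM; last first.
  by have := ltn_ord i; lia.
by rewrite -natr1; ring.
Qed.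

(** * Injectivity of the tableau map *)

Lemma coroot_coefE (R : realType) n (i : 'I_n) (xi : 'rV[R]_n) : integral xi ->
  coroot_coef i xi = cc i xi.
Proof.
move=> h; rewrite /coroot_coef simple_coroots_coord.
suff -> : psum i xi = (cc i xi)%:~R by rewrite intrKfloor.
rewrite /cc rmorph_sum /= big_mkcond big_split_ord /= -big_mkcond [X in _ + X]big1 ?addr0.
  by apply: eq_bigr => l _; rewrite zlE // lvec_lshift dot_eps.
by move=> l _; have -> : (n + l <= i)%N = false by have := ltn_ord i; lia.
Qed.

(** Induction on the value of [f]: once all smaller values are matched, the next value of the common
    image must be taken by both maps at the same point. *)
Lemma order_pattern (D : finType) (A : {set D}) N (f g : D -> 'I_N) :
  {in A &, forall x y, (f x < f y)%N = (g x < g y)%N} -> f @: A = g @: A ->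
  {in A, f =1 g}.
Proof.
move=> fg e x; have [m] := ubnP (f x); elim: m x => // m IH x fxm xA.
have lt y : y \in A -> (f y < f x)%N -> f y = g y by move=> yA l; apply: IH => //; lia.
apply: val_inj; apply/eqP; rewrite eqn_leq /=; apply/andP; split.
  have : g x \in f @: A by rewrite e imset_f.
  case/imsetP => y yA ey; rewrite leqNgt ey; apply/negP => l.
  by move: (l); rewrite fg // -(lt _ yA l) ey ltnn.
have : f x \in g @: A by rewrite -e imset_f.
case/imsetP => y yA ey; rewrite leqNgt; apply/negP => l.
move: (l); rewrite {1}ey -fg // => l'.
by move: (l'); rewrite ey (lt _ yA l') ltnn.
Qed.

Lemma mem_tableau_set n (i : 'I_n) (w : weyl n) (b : letter n) :
  (b \in tableau_set i w) = (wfun w^-1%g b <= i)%N.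
Proof.
apply/imsetP/idP => [[u ui ->]|h]; first by rewrite wfunV; rewrite inE in ui.
have [s e] := letter_lshift (leq_ltn_trans h (ltn_ord i)).
by exists s; rewrite -?e ?wfunKV // inE; move: h; rewrite e.
Qed.

Lemma block_cases n (i : 'I_n) (a : letter n) : [\/ (a <= i)%N, mid i a | (sigma a <= i)%N].
Proof.
rewrite /mid; case: leqP => h1; first by constructor 1.
by case: leqP => h2; [constructor 3|constructor 2].
Qed.

(* Within the first block zl is nondecreasing with at most one step, of height 1,
   and such a sequence is determined by its sum. *)
Lemma cc_zl_inj (R : realType) n (i : 'I_n) (x y : waf R n) :
  in_WJaf [set~ i] x -> in_WJaf [set~ i] y -> cc i x.2 = cc i y.2 ->
  forall p : letter n, (p <= i)%N -> zl x.2 p = zl y.2 p.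
Proof.
suff H (x' y' : waf R n) : in_WJaf [set~ i] x' -> in_WJaf [set~ i] y' -> cc i x'.2 = cc i y'.2 ->
    forall p : letter n, (p <= i)%N -> zl x'.2 p <= zl y'.2 p.
  by move=> hx hy e p pl; apply/eqP; rewrite eq_le !H.
move=> /WJafP[_ hx] /WJafP[_ hy] e p pl; rewrite leNgt; apply/negP => l.
(* Both sequences rise by at most 1 in total, so an excess of [x'] over [y'] at one letter forbids a
   deficit at any other; equal sums then rule out the excess. *)
have le (q : letter n) : (q <= i)%N -> zl y'.2 q <= zl x'.2 q.
  move=> ql; case: (ltngtP p q) => pq.
  - have := hx _ _ pq (blk_lo pl ql); have := hy _ _ pq (blk_lo pl ql); rewrite /okp.
    by move: (zl _ _) (zl _ _) (zl _ _) (zl _ _) l; clear; lia.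
  - have := hx _ _ pq (blk_lo ql pl); have := hy _ _ pq (blk_lo ql pl); rewrite /okp.
    by move: (zl _ _) (zl _ _) (zl _ _) (zl _ _) l; clear; lia.
  by move/val_inj: pq => <-; exact: ltW.
have S : \sum_(q : letter n | (q <= i)%N) (zl x'.2 q - zl y'.2 q) = 0.
  by rewrite sumrB -!/(cc i _) e subrr.
have ge (q : letter n) : (q <= i)%N -> 0 <= zl x'.2 q - zl y'.2 q.
  by move=> ql; rewrite subr_ge0 le.
by have := psumr_eq0P ge S pl; move: l; lia.
Qed.

(** [cc] determines [zl], and [zl] determines through [okp] the relative order of the values of w in
    each block. The tableau determines the image of each block, so w is recovered block by block. *)
Lemma Ymap_inj (R : realType) n (i : 'I_n) (x y : waf R n) :
  in_WJaf [set~ i] x -> in_WJaf [set~ i] y ->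
  tableau_set i x.1 = tableau_set i y.1 -> cc i x.2 = cc i y.2 -> x = y.
Proof.
move=> hx hy eT ec; have [xi xok] := (WJafP i x).1 hx; have [yi yok] := (WJafP i y).1 hy.
have zlo := cc_zl_inj hx hy ec.
have z (p : letter n) : zl x.2 p = zl y.2 p.
  have [h|h|h] := block_cases i p; first exact: zlo.
    by rewrite (zl_mid hx h) (zl_mid hy h).
  by apply: oppr_inj; rewrite -!zl_sigma // zlo.
have pat (A : {set letter n}) : {in A &, forall a b, blk i a = blk i b} ->
   wfun x.1 @: A = wfun y.1 @: A -> {in A, wfun x.1 =1 wfun y.1}.
  move=> bA; apply: order_pattern => a b aA bA'.
  have [l|l|/val_inj -> //] := ltngtP a b; last by rewrite !ltnn.
    have := xok _ _ l (bA _ _ aA bA'); have := yok _ _ l (bA _ _ aA bA'); rewrite /okp !z.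
    by move: (zl _ _) (zl _ _) => u v; clear; lia.
  have := xok _ _ l (bA _ _ bA' aA); have := yok _ _ l (bA _ _ bA' aA); rewrite /okp !z.
  by move: (zl _ _) (zl _ _) => u v; clear; lia.
have imE (w : weyl n) (A : {set letter n}) b : (b \in wfun w @: A) = (wfun w^-1%g b \in A).
  by rewrite -{1}[b](wfunKV w) mem_imset //; exact: wfun_inj.
have wlo (a : letter n) : (a <= i)%N -> wfun x.1 a = wfun y.1 a.
  move=> al; apply: (pat [set a : letter n | (a <= i)%N]); rewrite ?inE //.
    by move=> b c; rewrite !inE; exact: blk_lo.
  by apply/setP => b; rewrite !imE !inE -!mem_tableau_set eT.
have wmid (a : letter n) : mid i a -> wfun x.1 a = wfun y.1 a.
  move=> al; apply: (pat [set a : letter n | mid i a]); rewrite ?inE //.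
    by move=> b c; rewrite !inE; exact: blk_mid.
  apply/setP => b; rewrite !imE !inE /mid -!wfun_sigma.
  by rewrite !ltnNge -!mem_tableau_set eT.
have ew : x.1 = y.1.
  apply: weylP => a; have [h|h|h] := block_cases i a; [exact: wlo|exact: wmid|].
  by apply: (can_inj (@sigmaK n)); rewrite -!wfun_sigma wlo.
have ex : x.2 = y.2.
  by apply/rowP => j; rewrite -!dot_eps -!lvec_lshift -!zlE // z.
by move: ew ex; case: (x) (y) => ? ? [? ?] /= -> ->.
Qed.

(** * Edges as right multiplications *)

(* r_beta x, written by means of a reflection on the right of x *)
Definition movex (R : realType) n (x : waf R n) (p q : letter n) (k : int) : waf R n :=
  (wcomp x.1 (wsw p q), k%:~R *: rt_coroot R p q + x.2).

Lemma rt_corootC (R : realType) n (p q : letter n) : rt_coroot R q p = - rt_coroot R p q.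
Proof.
have e : (p == sigma q) = (q == sigma p) by rewrite -sigma_eq eq_sym.
by rewrite /rt_coroot e; case: eqVneq => [->|_]; rewrite ?lvec_sigma ?rt_opp.
Qed.

Lemma rt_coroot_sigma (R : realType) n (p q : letter n) :
  rt_coroot R (sigma q) (sigma p) = rt_coroot R p q.
Proof.
have e : (p == sigma q) = (q == sigma p) by rewrite -sigma_eq eq_sym.
rewrite /rt_coroot rt_sigma (inj_eq (can_inj (@sigmaK n))) e.
by case: eqVneq => // ->; rewrite sigmaK.
Qed.

Lemma movexC (R : realType) n (x : waf R n) p q k : movex x q p k = movex x p q (- k).
Proof.
rewrite /movex rt_corootC scalerN rmorphN scaleNr; congr (_, _).
by apply: weylP => a; rewrite !wfun_comp !wfun_wsw swC.
Qed.

Lemma movex_sigma (R : realType) n (x : waf R n) p q k :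
  movex x (sigma q) (sigma p) k = movex x p q k.
Proof.
rewrite /movex rt_coroot_sigma; congr (_, _).
by apply: weylP => a; rewrite !wfun_comp !wfun_wsw sw_sigma2 swC.
Qed.

Lemma waf_mul_refl (R : realType) n (x : waf R n) (p q : letter n) (k : int) : p != q ->
  waf_mul (waf_refl (rt R (wfun x.1 p) (wfun x.1 q), k%:~R)) x = movex x p q k.
Proof.
move=> pq; rewrite /waf_mul /waf_refl /movex /=.
have npq : wfun x.1 p != wfun x.1 q by rewrite (inj_eq (@wfun_inj _ _)).
rewrite coroot_rt // wactZ wact_rt_coroot !wfunV wrefl_rt //; congr (_, _).
apply: weylP => a; rewrite !wfun_comp !wfun_wsw.
by apply: sw_conj => [|b]; [exact: wfun_inj|exact: wfun_sigma].
Qed.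

(** Pulling the root back by w names the reflection by letters on the right. Among the names related
    by [sigma], and by changing the signs of root and [k], one satisfies [hp]; [k] may then have
    either sign. *)
Lemma edge_movex (R : realType) n J (x y : waf R n) :
  (exists b, SiB_edge J x b y) ->
  si_length y = si_length x + 1 /\ exists p q k, hp p q /\ y = movex x p q k.
Proof.
move=> [[g m] [bpos _ _ ey sl]]; split=> //.
have [c [d [cd eg]]] : exists c d, c != d /\ g = rt R c d.
  case: bpos => /= [[/pos_rootsP[c [d [cd ->]]] _]|[/rootsP h _]] //.
  by exists c, d; rewrite ord_lt_neq.
have [k ek] : exists k : int, m = k%:~R.
  by case: bpos => /= [[_ ->]|[_ [k _ ->]]]; [exists 0|exists k].
move: ey; rewrite {}eg {}ek -[c](wfunKV x.1) -[d](wfunKV x.1).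
set p := wfun _ c; set q := wfun _ d.
have pq : p != q by rewrite (inj_eq (@wfun_inj _ _)).
rewrite waf_mul_refl //.
have [l|l] := ord_neq_lt pq; have [h|h] := hp_or_sigma l => ->.
- by exists p, q, k.
- by exists (sigma q), (sigma p), k; rewrite movex_sigma.
- by exists q, p, (- k); rewrite -movexC.
- by exists (sigma p), (sigma q), (- k); rewrite movex_sigma -movexC.
Qed.

Lemma movex_edge (R : realType) n J (x y : waf R n) p q k :
  in_WJaf J x -> in_WJaf J y -> si_length y = si_length x + 1 -> p != q ->
  y = movex x p q k -> exists b, SiB_edge J x b y.
Proof.
move=> hx hy sl pq ey.
(* An affine root and its negative give the same reflection, so the sign can be chosen to make the
   root positive. *)
wlog h : p q k pq ey / 0 < k \/ (k = 0 /\ (wfun x.1 p < wfun x.1 q)%N).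
  move=> H; have [k0|k0|k0] := ltgtP k 0.
  - apply: (H q p (- k)); [by rewrite eq_sym | by rewrite movexC opprK |].
    by left; rewrite oppr_gt0.
  - exact: (H p q k pq ey (or_introl k0)).
  have npq : wfun x.1 p != wfun x.1 q by rewrite (inj_eq (@wfun_inj _ _)).
  have [l|l] := ord_neq_lt npq; first exact: (H p q k pq ey (or_intror (conj k0 l))).
  apply: (H q p k); [by rewrite eq_sym | by rewrite movexC ey k0 oppr0 | by right].
exists (rt R (wfun x.1 p) (wfun x.1 q), k%:~R); split=> //; last by rewrite waf_mul_refl.
by apply/pos_aff_rt => //; rewrite (inj_eq (@wfun_inj _ _)).
Qed.

(* The pairing of the coroot of p - q with the letter r. *)
Definition shift n (p q r : letter n) : int :=
  if q == sigma p then (p == r)%:R - (p == sigma r)%:R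
  else (p == r)%:R - (p == sigma r)%:R - ((q == r)%:R - (q == sigma r)%:R).

Lemma integral_movex (R : realType) n (x : waf R n) p q k :
  integral x.2 -> integral (movex x p q k).2.
Proof.
move=> h j; rewrite /= mxE rpredD // mxE rpredM ?intr_int //.
have H a : lvec R a 0 j \is a Num.int.
  by case: (letterP a) => s; rewrite ?lvec_sigma ?mxE ?rpredN lvec_lshift eps0j natr_int.
by rewrite /rt_coroot; case: ifP => _ //; rewrite /rt !mxE rpredB.
Qed.

Lemma zl_movex (R : realType) n (x : waf R n) p q k r : integral x.2 ->
  zl (movex x p q k).2 r = zl x.2 r + k * shift p q r.
Proof.
move=> h; apply: (@intr_inj R); rewrite zlE; last exact: integral_movex.
rewrite rmorphD rmorphM /= zlE // dotDl dotZl addrC; congr (_ + _ * _).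
by rewrite /rt_coroot /shift; case: ifP => _;
  rewrite /rt ?dotBl !dot_lvec !rmorphB /= !rmorph_nat.
Qed.

(** * Variation of the semi-infinite length *)

(** [stat] over an arbitrary set of letters, so that the letters moved by a reflection can be split
    off one at a time. *)
Definition statA n (A : {set letter n}) (f : letter n -> letter n) : int :=
  2 * (\sum_(p in A) (f p)%:R) -
  \sum_(p in A) \sum_(q in A) (p != q)%:R * (sigma (f q) < f p)%N%:R.

Definition lo n (i : 'I_n) : {set letter n} := [set a : letter n | (a <= i)%N].

Lemma stat_statA n (i : 'I_n) f : stat i f = statA (lo i) f.
Proof.
have e (F : letter n -> int) : \sum_(p : letter n | (p <= i)%N) F p = \sum_(p in lo i) F p.
  by apply: eq_bigl => p; rewrite inE.
by rewrite /stat /statA !e; congr (_ - _); apply: eq_bigr => p _; rewrite e.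
Qed.

Lemma eq_statA n (A : {set letter n}) f g : {in A, f =1 g} -> statA A f = statA A g.
Proof.
move=> e; rewrite /statA; congr (_ * _ - _); first by apply: eq_bigr => p pA; rewrite e.
by apply: eq_bigr => p pA; apply: eq_bigr => q qA; rewrite !e.
Qed.

(** The count has the factor 2 because the condition [sigma (f r) < f p] is symmetric in [p] and
    [r]. *)
Lemma statA_D1 n (A : {set letter n}) f p : p \in A ->
  statA A f = 2 * ((f p)%:R - \sum_(r in A :\ p) (sigma (f r) < f p)%N%:R) + statA (A :\ p) f.
Proof.
move=> pA; rewrite /statA (big_setD1 p) //= [X in _ - X](big_setD1 p) //=.
rewrite [X in _ - (X + _)](big_setD1 p) //= eqxx mul0r add0r.
rewrite [X in _ - (X + _)](eq_bigr (fun r => (sigma (f r) < f p)%N%:R)); last first.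
  by move=> r /setD1P[rp _]; rewrite eq_sym rp mul1r.
rewrite [X in _ - (_ + X)](eq_bigr (fun r => (sigma (f r) < f p)%N%:R +
   \sum_(q in A :\ p) (r != q)%:R * (sigma (f q) < f r)%N%:R)); last first.
  move=> r /setD1P[rp _]; rewrite (big_setD1 p) //= rp mul1r.
  by rewrite -[(sigma (f p) < f r)%N]ltn_sigma sigmaK.
by rewrite big_split /=; ring.
Qed.

Lemma statA_perm n (A : {set letter n}) f s : injective s -> (forall r, (s r \in A) = (r \in A)) ->
  statA A (f \o s) = statA A f.
Proof.
move=> sI sA; rewrite /statA [in RHS](reindex_inj sI) [X in _ = _ - X](reindex_inj sI) /=.
under [in RHS]eq_bigl => p do rewrite sA.
congr (_ - _); apply: eq_big => [p|p _]; first by rewrite sA.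
rewrite [RHS](reindex_inj sI); apply: eq_big => [q|q _]; first by rewrite sA.
by rewrite (inj_eq sI).
Qed.

(** * Counting letters in an open interval *)

Definition between N (a b : 'I_N) : {set 'I_N} := [set d : 'I_N | (a < d < b)%N].

Lemma card_between N (a b : 'I_N) : (a < b)%N -> #|between a b| = (b - a.+1)%N.
Proof.
move=> ab; rewrite -sum1_card.
transitivity (\sum_(0 <= d < N | (a < d < b)%N) 1)%N.
  by rewrite big_mkord; apply: eq_bigl => d; rewrite inE.
rewrite -big_filter.
have -> : [seq d <- index_iota 0 N | (a < d < b)%N] = index_iota a.+1 b.
  apply: (@irr_sorted_eq _ ltn); rewrite ?iota_ltn_sorted //; first exact: ltn_trans.
  - by move=> d; rewrite /= ltnn.
  - by apply: sorted_filter; [exact: ltn_trans|exact: iota_ltn_sorted].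
  move=> d; rewrite mem_filter !mem_index_iota /=.
  by have := ltn_ord b; lia.
by rewrite big_const_nat iter_addn_0 mul1n.
Qed.

Lemma sum_between N (D : finType) (A : {set D}) (g : D -> 'I_N) (a b : 'I_N) :
  {in A &, injective g} ->
  \sum_(r in A) (a < g r < b)%N%:R = #|g @: A :&: between a b|%:R :> int.
Proof.
move=> gI; rewrite -natr_sum -sum1_card; congr (_%:R).
transitivity (\sum_(d in g @: A) (a < d < b)%N)%N; first by rewrite big_imset.
rewrite [LHS]big_mkcond [RHS]big_mkcond; apply: eq_bigr => d _.
by rewrite !inE; case: (d \in _) => //=; case: ifP.
Qed.

Lemma sum_between_le N (D : finType) (A : {set D}) (g : D -> 'I_N) (a b : 'I_N) :
  {in A &, injective g} -> (a < b)%N ->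
  \sum_(r in A) (a < g r < b)%N%:R <= b%:R - a%:R - 1 :> int.
Proof.
move=> gI ab; rewrite sum_between //.
have := subset_leq_card (subsetIr (g @: A) (between a b)).
by rewrite card_between //; lia.
Qed.

Lemma sum_between_eq N (D : finType) (A : {set D}) (g : D -> 'I_N) (a b : 'I_N) :
  {in A &, injective g} -> (a < b)%N ->
  \sum_(r in A) (a < g r < b)%N%:R = b%:R - a%:R - 1 :> int <->
  forall d : 'I_N, (a < d < b)%N -> exists2 r, r \in A & d = g r.
Proof.
move=> gI ab; rewrite sum_between //.
have -> : b%:R - a%:R - 1 = #|between a b|%:R :> int by rewrite card_between //; lia.
split=> [/eqP|h].
  rewrite eqr_nat => /eqP e d dab.
  have /setIidPr sub : g @: A :&: between a b = between a b.
    by apply/eqP; rewrite eqEcard subsetIr e leqnn.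
  have : d \in g @: A by apply: (subsetP sub); rewrite inE.
  by case/imsetP => r rA ->; exists r.
congr (_%:R); congr #|pred_of_set _|; apply/setIidPr/subsetP => d.
by rewrite inE => /h[r rA ->]; rewrite imset_f.
Qed.

(** Pigeonhole: only [N - (b - a + 1)] values lie outside the closed interval, and its endpoints are
    not taken. *)
Lemma sum_between_ge N (D : finType) (A : {set D}) (g : D -> 'I_N) (a b : 'I_N) :
  {in A &, injective g} -> (a < b)%N -> (forall r, r \in A -> g r != a /\ g r != b) ->
  #|A|%:R - (N%:R - (b%:R - a%:R + 1)) <= \sum_(r in A) (a < g r < b)%N%:R :> int.
Proof.
move=> gI ab gab; rewrite sum_between //.
have a_out : a \notin between a b by rewrite inE ltnn.
have b_out : b \notin a |: between a b by rewrite !inE ltnn andbF orbF ord_gt_neq.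
have : (#|g @: A| <= #|g @: A :&: between a b| + #|~: (b |: (a |: between a b))|)%N.
  rewrite (leq_trans _ (leq_card_setU _ _)) // subset_leq_card //.
  apply/subsetP => d /imsetP[r rA ->]; rewrite !inE; have [/negbTE-> /negbTE->] := gab _ rA.
  by rewrite imset_f //=; case: (_ && _).
rewrite card_in_imset // [X in (_ <= _ + X)%N]cardsCs setCK cardsU1 b_out cardsU1 a_out card_between // card_ord.
by have := ltn_ord b; lia.
Qed.

Arguments sigma : simpl never.

Lemma lo_neq_sigma n (i : 'I_n) (p q : letter n) : p \in lo i -> q \in lo i -> p != sigma q.
Proof.
rewrite !inE => pl ql; apply: ord_lt_neq; rewrite sigmaE.
by have := ltn_ord i; move: pl ql; lia.
Qed.

Lemma card_loE n (i : 'I_n) : #|lo i| = i.+1.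
Proof.
have := card_lo i; rewrite -(natr_sum _ _ _ (fun=> 1%N)) sum1_card => /eqP.
by rewrite eqr_nat => /eqP <-; apply: eq_card => a; rewrite !inE.
Qed.

Lemma card_lo_D1 n (i : 'I_n) p : p \in lo i -> #|lo i :\ p| = i :> nat.
Proof. by move=> pl; have := cardsD1 p (lo i); rewrite pl card_loE; lia. Qed.

Definition sym n (A : {set letter n}) : {set letter n} := A :|: [set sigma a | a in A].

Lemma sym_disj n (i : 'I_n) (A : {set letter n}) : A \subset lo i ->
  [disjoint A & [set sigma a | a in A]].
Proof.
move=> /subsetP Al; rewrite -setI_eq0; apply/eqP/setP => a; rewrite !inE.
apply/negP => /andP[aA /imsetP[b bA ab]].
by have := lo_neq_sigma (Al _ aA) (Al _ bA); rewrite ab eqxx.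
Qed.

Lemma sum_symE n (i : 'I_n) (A : {set letter n}) (F : letter n -> int) : A \subset lo i ->
  \sum_(r in sym A) F r = \sum_(r in A) (F r + F (sigma r)).
Proof.
move=> Al; transitivity (\sum_(r in [predU A & [set sigma a | a in A]]) F r).
  by apply: eq_bigl => r; rewrite !inE.
rewrite (bigU _ _ _ (sym_disj Al)) /=.
by rewrite big_imset ?big_split //= => a b _ _; exact: (can_inj (@sigmaK n)).
Qed.

Lemma card_sym n (i : 'I_n) (A : {set letter n}) : A \subset lo i -> #|sym A| = (2 * #|A|)%N.
Proof.
move=> Al; rewrite cardsU (eqP (_ : _ :&: _ == set0)) ?setI_eq0 ?(sym_disj Al) //.
rewrite cards0 card_imset; last exact: (can_inj (@sigmaK n)).
by rewrite subn0 mul2n -addnn.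
Qed.

(* The letters w r and sigma (w r), r in A, are 2 #|A| distinct letters. *)
Lemma sum_sym_bounds n (i : 'I_n) (w : weyl n) (A : {set letter n}) (a b : letter n) :
  A \subset lo i -> (a < b)%N ->
  (forall r, r \in A -> [/\ wfun w r != a, wfun w r != b,
     sigma (wfun w r) != a & sigma (wfun w r) != b]) ->
  (2 * #|A|%:R - (2 * n%:R - (b%:R - a%:R + 1)) : int) <=
  \sum_(r in A) ((a < wfun w r < b)%N%:R + (a < sigma (wfun w r) < b)%N%:R) <=
  (b%:R - a%:R - 1 : int).
Proof.
move=> Al ab wab; set X := \sum_(_ in _) _; have gI : {in sym A &, injective (wfun w)} by move=> ? ? _ _; exact: wfun_inj.
have -> : X = \sum_(r in sym A) (a < wfun w r < b)%N%:R.
  by rewrite (sum_symE _ Al); apply: eq_bigr => r _; rewrite wfun_sigma.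
apply/andP; split; last exact: sum_between_le.
have := sum_between_ge gI ab; rewrite (card_sym Al).
have -> : 2 * #|A|%:R - (2 * n%:R - (b%:R - a%:R + 1))
   = (2 * #|A|)%N%:R - ((n + n)%N%:R - (b%:R - a%:R + 1)) :> int by lia.
apply=> r; rewrite /sym inE => /orP[/wab[-> ->]//|/imsetP[s sA ->]].
by rewrite wfun_sigma; have [_ _ -> ->] := wab _ sA.
Qed.

(** For [a < b], half the variation is [b - a] minus the number of letters [sigma (w r)] strictly
    between, hence at least 1, with equality when they fill the gap. For [b < a] the signs reverse
    and it is at most -1. *)
Lemma stat_mid n (i : 'I_n) (w : weyl n) (p q : letter n) (a := wfun w p) (b := wfun w q) :
  p \in lo i -> mid i q ->
  statA (lo i) (wfun w \o sw p q) - statA (lo i) (wfun w) = 2 <->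
  (a < b)%N /\ forall d : letter n, (a < d < b)%N -> exists2 r, r \in lo i :\ p & d = sigma (wfun w r).
Proof.
move=> pl qm.
have qnl r : r \in lo i -> r != q /\ r != sigma q.
  rewrite inE => rl; move: (qm); rewrite /mid => /andP[q1 q2].
  by split; apply: ord_lt_neq; apply: leq_ltn_trans rl _.
have swr r : r \in lo i :\ p -> sw p q r = r.
  move=> /setD1P[rp rl]; have [r1 r2] := qnl _ rl.
  by rewrite sw_out //; exact: (lo_neq_sigma rl pl).
have e1 : (wfun w \o sw p q) p = b by rewrite /= swl.
rewrite !(statA_D1 _ pl) e1 -/a.
rewrite (@eq_statA _ _ (wfun w \o sw p q) (wfun w)); last by move=> r /swr /= ->.
rewrite (eq_bigr (fun r => (sigma (wfun w r) < b)%N%:R)); last by move=> r /swr /= ->.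
set S1 : int := \sum_(r in lo i :\ p) (sigma (wfun w r) < b)%N%:R.
set S2 : int := \sum_(r in lo i :\ p) (sigma (wfun w r) < a)%N%:R.
have ne r : r \in lo i :\ p -> sigma (wfun w r) != a /\ sigma (wfun w r) != b.
  move=> /setD1P[rp rl]; rewrite -wfun_sigma !(inj_eq (@wfun_inj _ _)) eq_sym (lo_neq_sigma pl rl).
  by rewrite sigma_eq; have [_ ->] := qnl _ rl.
have gI : {in lo i :\ p &, injective (fun r => sigma (wfun w r))}.
  by move=> r s _ _ /(can_inj (@sigmaK n)) /wfun_inj.
have : a != b by rewrite (inj_eq (@wfun_inj _ _)); have [] := qnl _ pl.
move=> /ord_neq_lt[ab|ba]; last first.
  have : S2 - S1 = \sum_(r in lo i :\ p) (b < sigma (wfun w r) < a)%N%:R.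
    rewrite -sumrB; apply: eq_bigr => r rA; have [h1 h2] := ne _ rA.
    have := ord_neq_lt h1; have := ord_neq_lt h2; move: ba.
    by move: (sigma _ : nat) (a : nat) (b : nat) => x y z; clear => *; do ?[case: ltnP => ? /=]; lia.
  have := sum_between_le gI ba; set S := \sum_(_ in _) _.
  by move: ba; move: S S1 S2; clear; lia.
have e : S1 - S2 = \sum_(r in lo i :\ p) (a < sigma (wfun w r) < b)%N%:R.
  rewrite -sumrB; apply: eq_bigr => r rA; have [h1 h2] := ne _ rA.
  have := ord_neq_lt h1; have := ord_neq_lt h2; move: ab.
  by move: (sigma _ : nat) (a : nat) (b : nat) => x y z; clear => *; do ?[case: ltnP => ? /=]; lia.
have E := sum_between_eq gI ab; rewrite -e in E.
split=> [h|[_ /E h]]; [split=> //; apply/E|]; move: h; clear; lia.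
Qed.

(** Half the variation is [sigma a - a], corrected by a count of letters [sigma (w r)] in between,
    plus [(2n - i) * k]. The count is less than half the length of the interval, so [k = 0] gives 1
    only from n to nbar. In a long interval the count cannot be small either: the drop from a barred
    letter is at most [2n - i - 1], attained only at 1bar, where [k = 1] leaves exactly 1. *)
Lemma stat_long n (i : 'I_n) (w : weyl n) (p : letter n) (k : int) : p \in lo i ->
  statA (lo i) (wfun w \o sw p (sigma p)) - statA (lo i) (wfun w) + 2 * (n + n - i)%N%:R * k = 2 <->
  (k = 0 /\ (wfun w p).+1 = n) \/ (k = 1 /\ (wfun w p).+1 = (n + n)%N).
Proof.
move=> pl; set a := wfun w p.
have swr r : r \in lo i :\ p -> sw p (sigma p) r = r.
  move=> /setD1P[rp rl].
  by rewrite sw_out ?sigmaK //; exact: (lo_neq_sigma rl pl).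
have e1 : (wfun w \o sw p (sigma p)) p = sigma a by rewrite /= swl wfun_sigma.
rewrite !(statA_D1 _ pl) e1 -/a.
rewrite (@eq_statA _ _ (wfun w \o sw p _) (wfun w)); last by move=> r /swr /= ->.
rewrite (eq_bigr (fun r => (sigma (wfun w r) < sigma a)%N%:R)); last by move=> r /swr /= ->.
set S1 : int := \sum_(r in lo i :\ p) (sigma (wfun w r) < sigma a)%N%:R.
set S2 : int := \sum_(r in lo i :\ p) (sigma (wfun w r) < a)%N%:R.
have ne r : r \in lo i :\ p -> [/\ wfun w r != a, wfun w r != sigma a,
    sigma (wfun w r) != a & sigma (wfun w r) != sigma a].
  move=> /setD1P[rp rl]; rewrite -!wfun_sigma !(inj_eq (@wfun_inj _ _)) rp.
  rewrite (inj_eq (can_inj (@sigmaK n))) rp [sigma r == p]eq_sym.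
  by rewrite (lo_neq_sigma rl pl) (lo_neq_sigma pl rl).
have Al : lo i :\ p \subset lo i by exact: subsetDl.
(* The interval from [b] to [sigma b] is stable under [sigma], so [w r] and [sigma (w r)] lie in it
   together. *)
have half (b c : letter n) : (c = sigma b :> nat) -> 2 * \sum_(r in lo i :\ p) (b < sigma (wfun w r) < c)%N%:R =
   \sum_(r in lo i :\ p) ((b < wfun w r < c)%N%:R + (b < sigma (wfun w r) < c)%N%:R) :> int.
  move=> ec; rewrite mulr_sumr; apply: eq_bigr => r _; rewrite ec !sigmaE.
  have := ltn_ord b; have := ltn_ord (wfun w r).
  by move: (b : nat) (wfun w r : nat) => y z; clear => *; do ?[case: ltnP => ? /=]; lia.
have nk : (i < n)%N := ltn_ord i.
(* The product with [k] is not linear; these bounds allow it to be replaced by a variable for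
   [lia]. *)
have kk : [\/ k = 0, (k < 0 /\ (n + n - i)%N%:R * k <= - (n + n - i)%N%:R) |
              k > 0 /\ ((n + n - i)%N%:R * k = (n + n - i)%N%:R /\ k = 1 \/
                 k > 1 /\ (n + n - i)%N%:R * k >= 2 * (n + n - i)%N%:R)].
  have [k0|k0|k0] := ltgtP k 0; [constructor 2; split=> //; nia | constructor 3 | constructor 1 => //].
  split=> //; have [k1|k1] : k = 1 \/ k > 1 by lia.
    by left; rewrite k1 mulr1.
  by right; split=> //; nia.
rewrite -mulrA; move: kk; set Kk := _ * k => kk.
have [an|na] := ltnP a n.
  have aa : (a < sigma a)%N by rewrite sigmaE; lia.
  have e : S1 - S2 = \sum_(r in lo i :\ p) (a < sigma (wfun w r) < sigma a)%N%:R.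
    rewrite -sumrB; apply: eq_bigr => r rA; have [_ _ h1 h2] := ne _ rA.
    have := ord_neq_lt h1; have := ord_neq_lt h2; move: aa.
    by move: (sigma _ : nat) (a : nat) (sigma a : nat) => x y z; clear => *; do ?[case: ltnP => ? /=]; lia.
  have := sum_sym_bounds Al aa ne; rewrite -half // -e card_lo_D1 //.
  have X0 : 0 <= S1 - S2 by rewrite e sumr_ge0.
  clear e half; case: kk => [k0|[k0 kk]|[k0 [[kk k1]|[k1 kk]]]].
  - rewrite /Kk k0 mulr0 sigmaE => h.
    by move: S1 S2 X0 h an nk (ltn_ord a) k0; clear; lia.
  - by move: Kk kk => K kk; rewrite sigmaE => h; move: S1 S2 X0 h an nk (ltn_ord a) k0 kk; clear; lia.
  - by move: Kk kk => K kk; rewrite sigmaE => h; move: S1 S2 X0 h an nk (ltn_ord a) k1 kk; clear; lia.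
  - by move: Kk kk => K kk; rewrite sigmaE => h; move: S1 S2 X0 h an nk (ltn_ord a) k1 kk; clear; lia.
have aa : (sigma a < a)%N by rewrite sigmaE; lia.
have e : S2 - S1 = \sum_(r in lo i :\ p) (sigma a < sigma (wfun w r) < a)%N%:R.
  rewrite -sumrB; apply: eq_bigr => r rA; have [_ _ h1 h2] := ne _ rA.
  have := ord_neq_lt h1; have := ord_neq_lt h2; move: aa.
  by move: (sigma _ : nat) (a : nat) (sigma a : nat) => x y z; clear => *; do ?[case: ltnP => ? /=]; lia.
have ne' r : r \in lo i :\ p -> [/\ wfun w r != sigma a, wfun w r != a,
    sigma (wfun w r) != sigma a & sigma (wfun w r) != a] by case/ne.
have h := sum_sym_bounds Al aa ne'; move: h; rewrite -half ?sigmaK // -e card_lo_D1 // => h.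
(* The bound by the number of summands makes the case of 1bar exact: there the lower bound on the
   count is also [i]. *)
have X0 : 0 <= S2 - S1 <= i%:R.
  rewrite e sumr_ge0 //= -[X in _ <= X%:R](card_lo_D1 pl) -sumr_const.
  by apply: ler_sum => r _; case: (_ && _).
clear e half; case: kk => [k0|[k0 kk]|[k0 [[kk k1]|[k1 kk]]]].
- move: h; rewrite /Kk k0 mulr0 sigmaE => h.
  by move: S1 S2 X0 h na nk (ltn_ord a) k0; clear; lia.
- by move: Kk kk h => K kk; rewrite sigmaE => h; move: S1 S2 X0 h na nk (ltn_ord a) k0 kk; clear; lia.
- by move: Kk kk h => K kk; rewrite sigmaE => h; move: S1 S2 X0 h na nk (ltn_ord a) k1 kk; clear; lia.
- by move: Kk kk h => K kk; rewrite sigmaE => h; move: S1 S2 X0 h na nk (ltn_ord a) k1 kk; clear; lia.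
Qed.

(** Write D for [sigma b - a]. Half the variation is 2D, minus the sign of D for the pair itself,
    corrected by a count of the other letters and their [sigma]-images in between, plus
    [2 * (2n - i) * k]; the 2 is there because [zl] changes by [k] at both [p] and [t]. For [k = 0]
    and D > 0 it is at least D, so it is 1 only for D = 1. *)
Lemma stat_short n (i : 'I_n) (w : weyl n) (p t : letter n) (k : int) :
  p \in lo i -> t \in lo i -> p != t ->
  statA (lo i) (wfun w \o sw p (sigma t)) - statA (lo i) (wfun w) + 4 * (n + n - i)%N%:R * k = 2 <->
  k = 0 /\ (wfun w p + wfun w t).+2 = (n + n)%N.
Proof.
move=> pl tl pt; set a := wfun w p; set b := wfun w t; pose A := lo i :\ p :\ t.
have tp : t \in lo i :\ p by rewrite in_setD1 eq_sym pt.
have Ap r : r \in A -> [/\ r \in lo i, r != p & r != t] by rewrite !in_setD1 => /and3P[].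
have swo r : r \in A -> sw p (sigma t) r = r.
  move=> /Ap[rl rp rt].
  by rewrite sw_out ?sigmaK // ?(lo_neq_sigma rl pl) ?(lo_neq_sigma rl tl).
have e1 : (wfun w \o sw p (sigma t)) p = sigma b by rewrite /= swl wfun_sigma.
have e2 : (wfun w \o sw p (sigma t)) t = sigma a.
  by rewrite /= -[t in sw _ _ t]sigmaK sw_sigma swr wfun_sigma.
have D2 f : statA (lo i) f = 2 * ((f p)%:R - ((sigma (f t) < f p)%N%:R +
    \sum_(r in A) (sigma (f r) < f p)%N%:R)) +
    (2 * ((f t)%:R - \sum_(r in A) (sigma (f r) < f t)%N%:R) + statA A f).
  by rewrite (statA_D1 _ pl) (statA_D1 _ tp) (big_setD1 t tp).
rewrite !D2 e1 e2 -/a -/b sigmaK.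
rewrite (@eq_statA _ A (wfun w \o sw p (sigma t)) (wfun w)); last by move=> r /swo /= ->.
have swS c : \sum_(r in A) (sigma ((wfun w \o sw p (sigma t)) r) < c)%N%:R =
   \sum_(r in A) (sigma (wfun w r) < c)%N%:R :> int by apply: eq_bigr => r /swo /= ->.
rewrite !swS; move: (statA A _) => St.
set Ssb : int := \sum_(r in A) (sigma (wfun w r) < sigma b)%N%:R.
set Ssa : int := \sum_(r in A) (sigma (wfun w r) < sigma a)%N%:R.
set Sb : int := \sum_(r in A) (sigma (wfun w r) < b)%N%:R.
set Sa : int := \sum_(r in A) (sigma (wfun w r) < a)%N%:R.
have nab : a != sigma b by rewrite -wfun_sigma (inj_eq (@wfun_inj _ _)) (lo_neq_sigma pl tl).
have ab : a != b by rewrite (inj_eq (@wfun_inj _ _)).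
have ne r : r \in A -> [/\ wfun w r != a, wfun w r != sigma b,
    sigma (wfun w r) != a & sigma (wfun w r) != sigma b].
  move=> /Ap[rl rp rt]; rewrite -!wfun_sigma !(inj_eq (@wfun_inj _ _)) rp.
  rewrite (inj_eq (can_inj (@sigmaK n))) rt [sigma r == p]eq_sym.
  by rewrite (lo_neq_sigma rl tl) (lo_neq_sigma pl rl).
have ne' r : r \in A -> [/\ wfun w r != sigma b, wfun w r != a,
    sigma (wfun w r) != sigma b & sigma (wfun w r) != a] by case/ne.
have Al : A \subset lo i by apply/subsetP => r /Ap[].
have cA : #|A|.+1 = i by rewrite -(card_lo_D1 pl) (cardsD1 t (lo i :\ p)) tp.
have nk : (i < n)%N := ltn_ord i.
have kk : [\/ k = 0, (k < 0 /\ (n + n - i)%N%:R * k <= - (n + n - i)%N%:R) |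
              k > 0 /\ (n + n - i)%N%:R * k >= (n + n - i)%N%:R].
  have [k0|k0|k0] := ltgtP k 0; [constructor 2|constructor 3|by constructor 1];
  by split=> //; nia.
rewrite -[4 * _ * _]mulrA; move: kk; set Kk := _ * k => kk.
(* Distinctness keeps the distance from [a] to [sigma b] at most 2n - 2; this prevents [k = 1] from
   giving the value 1, as it does for a long root. *)
have := ltn_ord a; have := ltn_ord b; have abn : (a : nat) <> b by move/val_inj => e; rewrite e eqxx in ab.
have sa := sigmaE a; have sb := sigmaE b => bn an.
have [l|l] := ord_neq_lt nab.
  have e : (Ssb - Sa) + (Ssa - Sb) = \sum_(r in A)
    ((a < wfun w r < sigma b)%N%:R + (a < sigma (wfun w r) < sigma b)%N%:R).
    rewrite -!sumrB -big_split; apply: eq_bigr => r rA /=; have [h1 h2 h3 h4] := ne _ rA.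
    have := ord_neq_lt h1; have := ord_neq_lt h2; have := ord_neq_lt h3; have := ord_neq_lt h4.
    have := ltn_ord (wfun w r); move: l an bn; rewrite !sigmaE.
    move: (wfun w r : nat) (a : nat) (b : nat) => x y z; clear => *.
    by do ?[case: ltnP => ? /=]; lia.
  have := sum_sym_bounds Al l ne; rewrite -e => h.
  have X0 : 0 <= (Ssb - Sa) + (Ssa - Sb) by rewrite e sumr_ge0 // => r _; rewrite addr_ge0.
  rewrite (_ : (sigma b < a)%N = false); last by apply/negbTE; rewrite -leqNgt ltnW.
  rewrite l /= => {e}; move: h X0; rewrite sb => h X0; rewrite sb in l; case: kk => [k0|[k0 kk]|[k0 kk]].
  - rewrite /Kk k0 mulr0; clear -h X0 l cA nk bn an abn sa sb.
    by move: (a : nat) (b : nat) h X0 l nk bn an abn cA sa sb => y z; lia.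
  - move: Kk kk => K kk; clear -h X0 l cA nk bn an abn sa sb k0 kk.
    by move: (a : nat) (b : nat) h X0 l nk bn an abn cA sa sb => y z; lia.
  - move: Kk kk => K kk; clear -h X0 l cA nk bn an abn sa sb k0 kk.
    by move: (a : nat) (b : nat) h X0 l nk bn an abn cA sa sb => y z; lia.
have e : (Sa - Ssb) + (Sb - Ssa) = \sum_(r in A)
  ((sigma b < wfun w r < a)%N%:R + (sigma b < sigma (wfun w r) < a)%N%:R).
  rewrite -!sumrB -big_split; apply: eq_bigr => r rA /=; have [h1 h2 h3 h4] := ne _ rA.
  have := ord_neq_lt h1; have := ord_neq_lt h2; have := ord_neq_lt h3; have := ord_neq_lt h4.
  have := ltn_ord (wfun w r); move: l an bn; rewrite !sigmaE.
  move: (wfun w r : nat) (a : nat) (b : nat) => x y z; clear => *.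
  by do ?[case: ltnP => ? /=]; lia.
have := sum_sym_bounds Al l ne'; rewrite -e => h.
have X0 : 0 <= (Sa - Ssb) + (Sb - Ssa) by rewrite e sumr_ge0 // => r _; rewrite addr_ge0.
rewrite (_ : (a < sigma b)%N = false); last by apply/negbTE; rewrite -leqNgt ltnW.
rewrite l /= => {e}; move: h X0; rewrite sb => h X0; rewrite sb in l; case: kk => [k0|[k0 kk]|[k0 kk]].
- rewrite /Kk k0 mulr0; clear -h X0 l cA nk bn an abn sa sb.
  by move: (a : nat) (b : nat) h X0 l nk bn an abn cA sa sb => y z; lia.
- move: Kk kk => K kk; clear -h X0 l cA nk bn an abn sa sb k0 kk.
  by move: (a : nat) (b : nat) h X0 l nk bn an abn cA sa sb => y z; lia.
- move: Kk kk => K kk; clear -h X0 l cA nk bn an abn sa sb k0 kk.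
  by move: (a : nat) (b : nat) h X0 l nk bn an abn cA sa sb => y z; lia.
Qed.

(** * Entries of tableaux *)

Lemma si_diff (R : realType) n (i : 'I_n) (x y : waf R n) :
  in_WJaf [set~ i] x -> in_WJaf [set~ i] y ->
  si_length y = si_length x + 1 <->
  statA (lo i) (wfun y.1) - statA (lo i) (wfun x.1)
    + 2 * (n + n - i)%N%:R * (cc i y.2 - cc i x.2) = 2.
Proof.
move=> hx hy; have := si_lengthE hx; have := si_lengthE hy; rewrite !stat_statA.
set cst := \sum_(_ < _ | _) _; move=> ey ex.
have -> : si_length y = si_length x + 1 <-> 2 * si_length y = 2 * si_length x + 2.
  by split=> [->|]; lra.
rewrite ex ey (_ : 2 = (2 : int)%:~R :> R) // -rmorphD.
split=> [/intr_inj|] h; [|congr (_%:~R)]; move: h; clear; lia.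
Qed.

Lemma okp_sigma (R : realType) n (x : waf R n) a b : integral x.2 ->
  okp x a b -> okp x (sigma b) (sigma a).
Proof.
move=> xi; rewrite /okp !zl_sigma // !wfun_sigma !ltn_sigma.
by move: (zl _ _) (zl _ _) => u v; clear; lia.
Qed.

Lemma WJaf_intro (R : realType) n (i : 'I_n) (x : waf R n) : integral x.2 ->
  (forall a b, a \in lo i -> b \in lo i -> (a < b)%N -> okp x a b) ->
  (forall a b, mid i a -> mid i b -> (a < b)%N -> okp x a b) ->
  in_WJaf [set~ i] x.
Proof.
move=> xi hl hm; apply/WJafP; split=> // a b ab e.
have [al|am|au] := block_cases i a; have [bl|bm|bu] := block_cases i b.
- by apply: hl; rewrite ?inE.
- by move: e bm al; rewrite /blk /mid; move: (ltn_ord i); rewrite sigmaE; lia.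
- by move: e bu al; rewrite /blk; move: (ltn_ord i); rewrite !sigmaE; lia.
- by move: e am bl; rewrite /blk /mid; move: (ltn_ord i); rewrite sigmaE; lia.
- exact: hm.
- by move: e am bu; rewrite /blk /mid; move: (ltn_ord i); rewrite !sigmaE; lia.
- by move: e au bl; rewrite /blk; move: (ltn_ord i); rewrite !sigmaE; lia.
- by move: e au bm; rewrite /blk /mid; move: (ltn_ord i); rewrite !sigmaE; lia.
rewrite -[a]sigmaK -[b]sigmaK; apply: okp_sigma => //.
by apply: hl; rewrite ?inE // ltn_sigma.
Qed.

Lemma entry_mono n k (T : CST n k) (u v : 'I_k) : (u < v)%N -> (entry T u < entry T v)%N.
Proof.
move=> uv; rewrite /entry /enum_val.
set u' := cast_ord _ u; set v' := cast_ord _ v.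
have S : sorted ltn [seq val a | a <- enum (val T)].
  apply: (subseq_sorted ltn_trans _ (iota_ltn_sorted 0 (n + n))).
  rewrite -val_enum_ord; apply: map_subseq.
  by rewrite [X in subseq _ X]enumT; exact: filter_subseq.
have sz : size [seq val a | a <- enum (val T)] = k by rewrite size_map -cardE card_CST.
have un : (u < size (enum (val T)))%N by rewrite -cardE card_CST.
have vn : (v < size (enum (val T)))%N by rewrite -cardE card_CST.
rewrite -(nth_map _ 0%N) //; rewrite -[X in (_ < X)%N](nth_map _ 0%N) //.
by apply: (sorted_ltn_nth ltn_trans 0%N S) => //; rewrite inE sz; first [exact: (ltn_ord u) | exact: (ltn_ord v)].
Qed.

Lemma entry_mem n k (T : CST n k) (u : 'I_k) : entry T u \in val T.
Proof. exact: enum_valP. Qed.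

Lemma entry_inj n k (T : CST n k) : injective (entry T).
Proof. by move=> u v /enum_val_inj /cast_ord_inj. Qed.

Lemma entry_surj n k (T : CST n k) a : a \in val T -> exists u, a = entry T u.
Proof.
move=> aT; exists (cast_ord (card_CST T) (enum_rank_in aT a)).
by rewrite /entry cast_ordK enum_rankK_in.
Qed.

(** The entries are the only increasing enumeration of the tableau, by [order_pattern]; the entries
    after a reflection are computed through this. *)
Lemma entry_char n k (T : CST n k) (g : 'I_k -> letter n) :
  (forall u v : 'I_k, (u < v)%N -> (g u < g v)%N) -> (forall u, g u \in val T) ->
  forall u, entry T u = g u.
Proof.
move=> gm gT u; have gI : injective g.
  move=> a b e; apply: val_inj; case: (ltngtP a b) => // /gm; by rewrite e ltnn.
apply: (@order_pattern _ [set: 'I_k]); last by rewrite inE.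
  move=> a b _ _; case: (ltngtP a b) => [h|h|/val_inj ->]; last by rewrite !ltnn.
    by rewrite gm // entry_mono.
    by rewrite ltnNge ltnW ?entry_mono // ltnNge ltnW ?gm.
transitivity (val T); [|apply/esym]; apply/eqP; rewrite eqEcard.
  rewrite card_imset ?card_CST ?cardsT ?card_ord ?leqnn ?andbT; last exact: entry_inj.
  by apply/subsetP => a /imsetP[v _ ->]; exact: entry_mem.
rewrite card_imset ?card_CST ?cardsT ?card_ord ?leqnn ?andbT //.
by apply/subsetP => a /imsetP[v _ ->].
Qed.

(** * From edges to tableaux *)

Lemma lo_mid_neq n (i : 'I_n) (r q : letter n) : r \in lo i -> mid i q -> r != q /\ r != sigma q.
Proof.
rewrite inE /mid => rl /andP[q1 q2].
by split; apply: ord_lt_neq; apply: leq_ltn_trans rl _.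
Qed.

Lemma cc_movex (R : realType) n (i : 'I_n) (x : waf R n) p q k : integral x.2 ->
  cc i (movex x p q k).2 = cc i x.2 + k * \sum_(r in lo i) shift p q r.
Proof.
move=> xi; rewrite /cc mulr_sumr.
have -> : \sum_(r in lo i) k * shift p q r = \sum_(r : letter n | (r <= i)%N) k * shift p q r.
  by apply: eq_bigl => r; rewrite inE.
by rewrite -big_split; apply: eq_bigr => r _; rewrite zl_movex.
Qed.

Lemma sum_eq_lo n (i : 'I_n) (p : letter n) : p \in lo i -> \sum_(r in lo i) (p == r)%:R = 1 :> int.
Proof.
move=> pl; rewrite (big_setD1 p) //= eqxx big1 ?addr0 // => r /setD1P[rp _].
by rewrite eq_sym (negbTE rp).
Qed.

Lemma shift_long n (i : 'I_n) (p r : letter n) : p \in lo i -> r \in lo i ->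
  shift p (sigma p) r = (p == r)%:R.
Proof. by move=> pl rl; rewrite /shift eqxx (negbTE (lo_neq_sigma pl rl)) subr0. Qed.

Lemma shift_short n (i : 'I_n) (p t r : letter n) : p \in lo i -> t \in lo i -> r \in lo i ->
  p != t -> shift p (sigma t) r = (p == r)%:R + (t == r)%:R.
Proof.
move=> pl tl rl pt; rewrite /shift (inj_eq (can_inj (@sigmaK n))) [t == p]eq_sym (negbTE pt).
rewrite (negbTE (lo_neq_sigma pl rl)) sigma_eq (negbTE (lo_neq_sigma tl rl)).
by rewrite (inj_eq (can_inj (@sigmaK n))) subr0 sub0r opprK.
Qed.

Lemma shift_lo_mid n (i : 'I_n) (p q : letter n) : p \in lo i -> mid i q ->
  shift p q q = -1.
Proof.
move=> pl qm; have [h1 h2] := lo_mid_neq pl qm; rewrite /shift.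
by rewrite -sigma_eq eq_sym (negbTE h2) (negbTE h1) eqxx neq_sigma !subr0 sub0r.
Qed.

Lemma sw_lo n (i : 'I_n) (p q r : letter n) : (p \in lo i) = (q \in lo i) ->
  (sigma p \in lo i) = (sigma q \in lo i) -> (sw p q r \in lo i) = (r \in lo i).
Proof.
move=> h1 h2; rewrite /sw; case: (eqVneq r p) => [->|_] //; case: (eqVneq r q) => [->|_] //.
by case: (eqVneq r (sigma p)) => [->|_] //; case: (eqVneq r (sigma q)) => [->|_].
Qed.

Lemma movex_inv (R : realType) n (i : 'I_n) (x : waf R n) p q k : (2 <= n)%N ->
  in_WJaf [set~ i] x -> in_WJaf [set~ i] (movex x p q k) ->
  si_length (movex x p q k) = si_length x + 1 -> hp p q ->
  [\/ [/\ p \in lo i, mid i q, k = 0, (wfun x.1 p < wfun x.1 q)%N &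
        forall d : letter n, (wfun x.1 p < d < wfun x.1 q)%N ->
          exists2 r, r \in lo i :\ p & d = sigma (wfun x.1 r)],
      [/\ p \in lo i, q = sigma p, k = 0 & (wfun x.1 p).+1 = n],
      [/\ p \in lo i, q = sigma p, k = 1 & (wfun x.1 p).+1 = (n + n)%N] |
      exists t, [/\ p \in lo i, t \in lo i, p != t, q = sigma t &
        k = 0 /\ (wfun x.1 p + wfun x.1 t).+2 = (n + n)%N]].
Proof.
move=> n2 hx hy sl /andP[pq pqn]; have := (si_diff hx hy).1 sl => {sl}.
have [xi _] := (WJafP i x).1 hx.
rewrite cc_movex // [_ + _ - cc i x.2]addrC addKr.
have -> : statA (lo i) (wfun (movex x p q k).1) = statA (lo i) (wfun x.1 \o sw p q).
  by apply: eq_statA => r _; rewrite wfun_comp wfun_wsw.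
(* A reflection that maps the first block to itself keeps [statA], so twice the length changes by a
   multiple of [2 * (2n - i)], which is never 2. *)
have none : (forall r, (sw p q r \in lo i) = (r \in lo i)) -> statA (lo i) (wfun x.1 \o sw p q)
     - statA (lo i) (wfun x.1)
     + 2 * (n + n - i)%N%:R * (k * \sum_(r in lo i) shift p q r) = 2 -> False.
  move=> h; rewrite statA_perm //; last exact: (can_inj (@swK n p q)).
  rewrite subrr add0r; move: (k * _) => u e.
  have := ltn_ord i; have : u <= 0 \/ 0 < u by lia.
  by case=> hu il; move: e; nia.
case: (boolP (p \in lo i)) => pl; last first.
  move=> h; exfalso; apply: none h => r; apply: sw_lo; move: pl pq pqn (ltn_ord i);
    by rewrite !inE ?sigmaE; have := ltn_ord q; have := ltn_ord p; clear; lia.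
have [ql|qm|qu] := block_cases i q.
- move=> h; exfalso; apply: none h => r; apply: sw_lo; move: pl ql (ltn_ord i);
    by rewrite !inE ?sigmaE; have := ltn_ord q; have := ltn_ord p; clear; lia.
(* [zl] vanishes at the middle letter [q] before and after the move, and the move changes it by
   [- k]. *)
- have k0 : k = 0.
    have := zl_movex p q k q xi; rewrite (zl_mid hx qm) (zl_mid hy qm) (shift_lo_mid pl qm).
    by clear; lia.
  rewrite k0 mul0r mulr0 addr0 => /(stat_mid _ pl qm)[ab h].
  by constructor 1.
have tl : sigma q \in lo i by rewrite inE.
have [e|pt] := eqVneq p (sigma q).
  have {}e : q = sigma p by rewrite e sigmaK.
  rewrite e (eq_bigr (fun r => (p == r)%:R)); last by move=> r rl; rewrite (shift_long pl rl).
  rewrite sum_eq_lo // mulr1 => /(stat_long _ _ pl)[[k0 h]|[k1 h]].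
    by constructor 2.
  by constructor 3.
rewrite -[q]sigmaK; move: (sigma q) tl pt => t tl pt.
rewrite (eq_bigr (fun r => (p == r)%:R + (t == r)%:R)); last by move=> r rl; rewrite (shift_short pl tl rl pt).
rewrite big_split /= !sum_eq_lo // => h.
constructor 4; exists t; split=> //; apply/(stat_short _ _ pl tl pt).
by move: h; clear; lia.
Qed.

Lemma tableau_neq_sigma n (i : 'I_n) (w : weyl n) a b :
  a \in tableau_set i w -> b \in tableau_set i w -> a != sigma b.
Proof.
rewrite !mem_tableau_set => al bl.
rewrite -(inj_eq (@wfun_inj _ w^-1%g)) wfun_sigma.
by apply: (@lo_neq_sigma _ i); rewrite inE.
Qed.

Lemma mem_tableau_wfun n (i : 'I_n) (w : weyl n) p : (wfun w p \in tableau_set i w) = (p \in lo i).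
Proof. by rewrite mem_tableau_set wfunV inE. Qed.

Lemma mem_tableau_sw n (i : 'I_n) (w : weyl n) p q c :
  (sw (wfun w p) (wfun w q) c \in tableau_set i (wcomp w (wsw p q))) = (c \in tableau_set i w).
Proof.
rewrite -[c](wfunKV w) sw_conj; [|exact: wfun_inj|exact: wfun_sigma].
by rewrite -wfun_wsw -wfun_comp !mem_tableau_wfun.
Qed.

Lemma entry_sw n (i : 'I_n) (w : weyl n) p q (T := tableau i w) (a := wfun w p) (b := wfun w q) :
  (forall u v : 'I_i.+1, (u < v)%N -> (sw a b (entry T u) < sw a b (entry T v))%N) ->
  forall u, entry (tableau i (wcomp w (wsw p q))) u = sw a b (entry T u).
Proof.
move=> h; apply: entry_char => // u.
by rewrite /= mem_tableau_sw; exact: (entry_mem T u).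
Qed.

Definition rise n k (T T' : CST n k) (s : 'I_k) : Prop :=
  ((entry T s).+1 < n)%N /\
  is_min ([set a : letter n | (entry T s < a)%N && (a < n)%N]
           :\: [set lnorm (entry T u) | u : 'I_k & (n <= entry T u)%N])
         (entry T' s).

Definition rise_bar n k (T T' : CST n k) (s : 'I_k) : Prop :=
  [/\ (n <= entry T s)%N, ((entry T s).+1 < n + n)%N &
      exists2 a : letter n,
        is_max ([set a : letter n | (a < lnorm (entry T s))%N]
                :\: [set entry T u | u : 'I_k & (entry T u < n)%N])
               a
      & entry T' s = sigma a].

Lemma lnorm_ge n (a : letter n) : (n <= a)%N -> lnorm a = sigma a.
Proof. by rewrite /lnorm ltnNge => ->. Qed.

(** * Exchange of an entry with a middle letter *)

Section MidCase.
Variables (n : nat) (i : 'I_n) (w : weyl n) (p q : letter n).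
Hypotheses (pl : p \in lo i) (qm : mid i q).
Let a := wfun w p.
Let b := wfun w q.
Let T := tableau i w.
Let T' := tableau i (wcomp w (wsw p q)).

Lemma mid_notin : b \notin val T /\ sigma b \notin val T.
Proof.
have [h1 h2] : q \notin lo i /\ sigma q \notin lo i.
  by move: qm; rewrite /mid !inE -!ltnNge => /andP.
by rewrite /T /= -wfun_sigma !mem_tableau_wfun.
Qed.

Lemma mid_swT c : c \in val T -> sw a b c = if c == a then b else c.
Proof.
move=> cT; have [h1 h2] := mid_notin; have aT : a \in val T by rewrite /T /= mem_tableau_wfun.
rewrite /sw; case: eqVneq => // ca.
have -> : (c == b) = false by apply/negbTE; apply: contraNneq h1 => <-.
have -> : (c == sigma a) = false by apply/negbTE; exact: (tableau_neq_sigma cT aT).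
by have -> : (c == sigma b) = false by apply/negbTE; apply: contraNneq h2 => <-.
Qed.

Hypothesis ab : (a < b)%N.
Hypothesis gap : forall d : letter n, (a < d < b)%N -> exists2 r, r \in lo i :\ p & d = sigma (wfun w r).

Lemma gapT (d : letter n) : (a < d < b)%N -> sigma d \in val T /\ sigma d != a.
Proof.
move/gap => [r /setD1P[rp rl] ->]; rewrite sigmaK /T /= mem_tableau_wfun; split=> //.
by rewrite (inj_eq (@wfun_inj _ _)).
Qed.

(** A tableau never contains a letter together with its [sigma]-image, so no entry lies in the gap;
    hence [b] takes the position of [a]. *)
Lemma gap_notin (d : letter n) : (a < d <= b)%N -> d \notin val T.
Proof.
rewrite [(d <= b)%N]leq_eqVlt => /andP[ad /orP[/eqP/val_inj ->|db]]; first by case: mid_notin.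
have [h1 _] := @gapT d (introT andP (conj ad db)).
by apply/negP => h2; have := tableau_neq_sigma h1 h2; rewrite eqxx.
Qed.

Lemma mid_entries u : entry T' u = if entry T u == a then b else entry T u.
Proof.
rewrite -mid_swT ?entry_mem //; apply: entry_sw => {}u v uv.
rewrite !mid_swT ?entry_mem //; have := entry_mono T uv.
case: eqVneq => [->|ua]; case: eqVneq => [->|va] l //.
- by rewrite ltnn in l.
- have := @gap_notin (entry T v); rewrite entry_mem l /= ltnNge.
  by case: leqP => // _ /(_ isT).
by apply: ltn_trans ab.
Qed.

(** Suppose [b] is barred. If nbar is strictly inside the gap, n is an entry other than [a], hence n
    is inside as well and nbar is an entry: impossible. Otherwise [b] is nbar, and n, being [a] or
    inside, puts [sigma b] or [b] into the tableau. *)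
Lemma mid_no_cross : (a < n)%N -> (b < n)%N.
Proof.
move=> an; rewrite ltnNge; apply/negP => nb.
have dn : (n < n + n)%N by move: an (ltn_ord b); clear; lia.
pose d : letter n := Ordinal dn; have ds : sigma d = n.-1 :> nat by rewrite sigmaE /=; lia.
have [bT sbT] := mid_notin; have aT : a \in val T by rewrite /T /= mem_tableau_wfun.
have key : sigma d != a -> d \in val T.
  move=> sda; have h : (a < sigma d < b)%N.
    have := ord_neq_lt sda; rewrite ds; move: an nb; clear; lia.
  by have [] := gapT h; rewrite sigmaK.
have [db|db] : (d < b)%N \/ b = d.
  move: nb; rewrite leq_eqVlt => /orP[/eqP e|]; [by right; apply: val_inj|by left].
  have h : (a < d < b)%N by rewrite db andbT.
  have [h1 h2] := gapT h.
  by have := tableau_neq_sigma h1 (key h2); rewrite eqxx.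
rewrite db in bT sbT; have [e|e] := eqVneq (sigma d) a; first by rewrite e aT in sbT.
by rewrite key in bT.
Qed.

Lemma entry_mid : exists2 s : 'I_i.+1,
  forall u, u != s -> entry T' u = entry T u & rise T T' s \/ rise_bar T T' s.
Proof.
have aT : a \in val T by rewrite /T /= mem_tableau_wfun.
have [bT sbT] := mid_notin.
have [s es] := entry_surj aT; exists s.
  by move=> u us; rewrite mid_entries es (inj_eq (@entry_inj _ _ T)) (negbTE us).
have e's : entry T' s = b by rewrite mid_entries es eqxx.
rewrite /rise /rise_bar e's -es; have [an|na] := ltnP a n.
  have bn := mid_no_cross an; left; split; first by move: ab bn; clear; lia.
  split=> [|d]; rewrite !inE.
    rewrite ab bn !andbT; apply/imsetP => -[u]; rewrite inE => nu eb.
    by move: sbT; rewrite eb lnorm_ge // sigmaK entry_mem.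
  move=> /andP[dn /andP[ad _]]; rewrite leqNgt; apply: contraNN dn => db.
  have [sT _] := @gapT d (introT andP (conj ad db)).
  have [u eu] := entry_surj sT; apply/imsetP; exists u; rewrite ?inE -eu ?sigma_geq.
    exact: ltn_trans db bn.
  by rewrite lnorm_ge ?sigmaK // sigma_geq (ltn_trans db bn).
right; split=> //; first by move: ab (ltn_ord b); clear; lia.
exists (sigma b); last by rewrite sigmaK.
rewrite lnorm_ge //; split=> [|d]; rewrite !inE.
  rewrite ltn_sigma ab andbT; apply/imsetP => -[u _ eb].
  by move: sbT; rewrite eb entry_mem.
move=> /andP[dn da]; rewrite leqNgt; apply: contraNN dn => db.
have h : (a < sigma d < b)%N by rewrite -ltn_sigma sigmaK da -ltn_sigma sigmaK db.
have [sT _] := gapT h; rewrite sigmaK in sT.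
have [u eu] := entry_surj sT; apply/imsetP; exists u => //; rewrite inE -eu.
by apply: ltn_trans da _; rewrite sigma_ltn.
Qed.

End MidCase.

(** * Entries that move to barred or unbarred opposites *)

Lemma long_swT n (i : 'I_n) (w : weyl n) a c :
  a \in tableau_set i w -> c \in tableau_set i w -> sw a (sigma a) c = if c == a then sigma a else c.
Proof.
move=> aT cT; rewrite /sw; case: eqVneq => // ca.
by rewrite (negbTE (tableau_neq_sigma cT aT)) sigmaK (negbTE ca).
Qed.

Lemma entry_long n (i : 'I_n) (w : weyl n) p (T := tableau i w)
    (T' := tableau i (wcomp w (wsw p (sigma p)))) :
  p \in lo i -> (wfun w p).+1 = n ->
  exists s : 'I_i.+1, [/\ forall u, u != s -> entry T' u = entry T u,
    sigma (entry T' s) = entry T s & (entry T s).+1 = n].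
Proof.
move=> pl an; have aT : wfun w p \in val T by rewrite /T /= mem_tableau_wfun.
have E u : entry T' u = if entry T u == wfun w p then sigma (wfun w p) else entry T u.
  rewrite -(long_swT aT (entry_mem T u)) -wfun_sigma; apply: entry_sw => {}u v uv.
  rewrite wfun_sigma -/T !(@long_swT _ i w) ?(entry_mem T) //; have := entry_mono T uv.
  case: eqVneq => [->|ua]; case: eqVneq => [->|va] l //.
  - by rewrite ltnn in l.
  - have := ord_neq_lt (tableau_neq_sigma (entry_mem T v) aT); move: l; rewrite !sigmaE; move: an; clear; lia.
  by move: l; rewrite sigmaE; move: an; clear; lia.
have [s es] := entry_surj aT; exists s; rewrite -es; split=> // [u us|].
  by rewrite E es (inj_eq (@entry_inj _ _ T)) (negbTE us).
by rewrite E es eqxx sigmaK.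
Qed.

(** 1bar is the largest letter, so it is the last entry; its image 1 is the smallest, so the other
    entries move one place up. *)
Lemma entry_wrap n (i : 'I_n) (w : weyl n) p (T := tableau i w)
    (T' := tableau i (wcomp w (wsw p (sigma p)))) :
  p \in lo i -> (wfun w p).+1 = (n + n)%N ->
  [/\ entry T' ord0 = 0%N :> nat,
      forall u v : 'I_i.+1, u = v.+1 :> nat -> entry T' u = entry T v &
      (entry T ord_max).+1 = (n + n)%N].
Proof.
move=> pl an; have aT : wfun w p \in val T by rewrite /T /= mem_tableau_wfun.
have [s es] := entry_surj aT.
have emax : entry T ord_max = wfun w p.
  rewrite es; congr (entry T _); apply: val_inj; apply/eqP; rewrite eqn_leq.
  apply/andP; split; last by rewrite -ltnS ltn_ord.
  rewrite leqNgt; apply/negP => h; have := entry_mono T h; rewrite -es.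
  by have := ltn_ord (entry T ord_max); rewrite -ltnS an; move: an; clear; lia.
have memT' c : c \in val T -> (if c == wfun w p then sigma (wfun w p) else c) \in val T'.
  by move=> cT; rewrite -(long_swT aT cT) -wfun_sigma /T' /= mem_tableau_sw.
pose g (u : 'I_i.+1) := if u == ord0 then sigma (wfun w p) else entry T (inord u.-1).
have E : forall u, entry T' u = g u.
  apply: entry_char => [u v uv|u]; rewrite /g.
    have -> : (v == ord0) = false by apply/negbTE; rewrite -val_eqE /= -lt0n; exact: leq_ltn_trans uv.
    case: eqVneq => [_|u0].
      have := ord_neq_lt (tableau_neq_sigma (entry_mem T (inord v.-1)) aT); rewrite sigmaE.
      by move: an; clear; lia.
    have {}u0 : (0 < u)%N by rewrite lt0n; exact: u0.
    have vi := ltn_ord v; apply: entry_mono.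
    by rewrite !inordK; move: uv u0 vi; clear; lia.
  case: eqVneq => [_|u0]; first by have := memT' _ aT; rewrite eqxx.
  have := memT' _ (entry_mem T (inord u.-1)).
  rewrite -emax (inj_eq (@entry_inj _ _ T)) -val_eqE /= inordK; last by have := ltn_ord u; lia.
  have {}u0 : (0 < u)%N by rewrite lt0n; exact: u0.
  by have -> : (u.-1 == i) = false by apply/negbTE; have := ltn_ord u; move: u0; clear; lia.
split; last by rewrite emax.
  by rewrite E /g eqxx sigmaE; move: an; clear; lia.
move=> u v uv; rewrite E /g -val_eqE /= uv /=; congr (entry T _).
by apply: val_inj; rewrite /= inordK.
Qed.

Lemma short_swT n (i : 'I_n) (w : weyl n) a b c :
  a \in tableau_set i w -> b \in tableau_set i w -> c \in tableau_set i w -> a != b ->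
  sw a (sigma b) c = if c == a then sigma b else if c == b then sigma a else c.
Proof.
move=> aT bT cT ab; rewrite /sw sigmaK; case: eqVneq => // ca.
by rewrite (negbTE (tableau_neq_sigma cT bT)) (negbTE (tableau_neq_sigma cT aT)).
Qed.

(** The hypothesis says that [sigma b = a + 1] and [sigma a = b + 1], with [a] and [b] the values at
    [p] and [t]: both letters advance one step, which keeps the order. The smaller one, necessarily
    unbarred, supplies the position [s]. *)
Lemma entry_short n (i : 'I_n) (w : weyl n) p t (T := tableau i w)
    (T' := tableau i (wcomp w (wsw p (sigma t)))) :
  p \in lo i -> t \in lo i -> p != t -> (wfun w p + wfun w t).+2 = (n + n)%N ->
  (0 < i)%N /\ exists s t : 'I_i.+1,
          [/\ (s < t)%N,
              forall u, u != s -> u != t -> entry T' u = entry T u &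
              [/\ entry T' s = (entry T s).+1 :> nat,
                  (entry T s).+1 = sigma (entry T t) :> nat,
                  sigma (entry T t) = (sigma (entry T' t)).+1 :> nat &
                  (sigma (entry T' t)).+1 < n]%N].
Proof.
move=> pl tl pt an; pose a := wfun w p; pose b := wfun w t.
have aT : a \in val T by rewrite /T /= mem_tableau_wfun.
have bT : b \in val T by rewrite /T /= mem_tableau_wfun.
have ab : a != b by rewrite (inj_eq (@wfun_inj _ _)).
have E u : entry T' u = if entry T u == a then sigma b else if entry T u == b then sigma a else entry T u.
  rewrite -(short_swT aT bT (entry_mem T u)) // -wfun_sigma; apply: entry_sw => {}u v uv.
  rewrite wfun_sigma -/T !(@short_swT _ i w) ?(entry_mem T) //; have := entry_mono T uv.
  have := ord_neq_lt (tableau_neq_sigma (entry_mem T v) bT); have := ord_neq_lt (tableau_neq_sigma (entry_mem T v) aT).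
  have := ord_neq_lt ab; move: an; rewrite -/a -/b.
  by do ![case: eqVneq => [->|?]]; rewrite !sigmaE; clear; lia.
have [s es] := entry_surj aT; have [r er] := entry_surj bT.
suff : exists s t : 'I_i.+1,
          [/\ (s < t)%N,
              forall u, u != s -> u != t -> entry T' u = entry T u &
              [/\ entry T' s = (entry T s).+1 :> nat,
                  (entry T s).+1 = sigma (entry T t) :> nat,
                  sigma (entry T t) = (sigma (entry T' t)).+1 :> nat &
                  (sigma (entry T' t)).+1 < n]%N].
  move=> [s' [t' [st h1 h2]]]; split; last by exists s', t'.
  by have := ltn_ord t'; move: st; clear; lia.
have oth u : u != s -> u != r -> entry T' u = entry T u.
  by move=> us ur; rewrite E es er !(inj_eq (@entry_inj _ _ T)) (negbTE us) (negbTE ur).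
have Es : entry T' s = sigma b by rewrite E es eqxx.
have Er : entry T' r = sigma a by rewrite E -er eq_sym (negbTE ab) eqxx.
have rs u v : (entry T u < entry T v)%N -> (u < v)%N.
  by case: (ltngtP u v) => // [h|/val_inj ->]; rewrite ?ltnn // ltnNge ltnW ?entry_mono.
have := ltn_ord a; have := ltn_ord b; move: an; rewrite -/a -/b => an bn an'.
have [l|l] := ord_neq_lt ab; [exists s, r|exists r, s].
  split=> //; first by apply: rs; rewrite -es -er.
  by rewrite Es Er -es -er !sigmaK !sigmaE; move: an l bn an'; clear; split; lia.
split=> //; first by apply: rs; rewrite -es -er.
  by move=> u ur us; exact: oth.
by rewrite Es Er -es -er !sigmaK !sigmaE; move: an l bn an'; clear; split; lia.
Qed.

(** * From tableaux to edges *)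

Lemma CST_eq n k (T T' : CST n k) : (forall u, entry T u \in val T') -> val T = val T'.
Proof.
move=> h; apply/eqP; rewrite eqEcard !card_CST leqnn andbT.
by apply/subsetP => a /entry_surj[u ->].
Qed.

(** [y] is recognised through [Ymap_inj]. The candidate lies in (W^J)_af since [zl] is unchanged and
    values in the first block compare as their positions in the tableau, which the move preserves;
    the last hypothesis takes care of the middle block. *)
Lemma movex0_eq (R : realType) n (i : 'I_n) (x y : waf R n) (p q : letter n) :
  in_WJaf [set~ i] x -> in_WJaf [set~ i] y -> cc i y.2 = cc i x.2 ->
  (forall u, entry (tableau i y.1) u = sw (wfun x.1 p) (wfun x.1 q) (entry (tableau i x.1) u)) ->
  (forall c d, mid i c -> mid i d -> (wfun x.1 c < wfun x.1 d)%N ->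
     (sw (wfun x.1 p) (wfun x.1 q) (wfun x.1 c) < sw (wfun x.1 p) (wfun x.1 q) (wfun x.1 d))%N) ->
  y = movex x p q 0.
Proof.
move=> hx hy ec eT hm; have [xi xok] := (WJafP i x).1 hx.
have ew c : wfun (movex x p q 0).1 c = sw (wfun x.1 p) (wfun x.1 q) (wfun x.1 c).
  rewrite wfun_comp wfun_wsw sw_conj //; [exact: wfun_inj|exact: wfun_sigma].
have ez c : zl (movex x p q 0).2 c = zl x.2 c by rewrite zl_movex // mul0r addr0.
apply: (@Ymap_inj _ _ i) => //.
- apply: WJaf_intro; first exact: integral_movex.
    move=> c d cl dl cd; have := xok _ _ cd (blk_lo _ _).
    move: (cl) (dl); rewrite !inE => -> -> /(_ isT isT); rewrite /okp !ez !ew.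
    have [u ->] : exists u, wfun x.1 c = entry (tableau i x.1) u by apply: entry_surj; rewrite /= mem_tableau_wfun.
    have [v ->] : exists u, wfun x.1 d = entry (tableau i x.1) u by apply: entry_surj; rewrite /= mem_tableau_wfun.
    rewrite -!eT; case: (ltngtP u v) => [h|h|/val_inj ->]; last by rewrite !ltnn => -[[]|[]].
      have hT (S : CST n i.+1) : (entry S v < entry S u)%N = false.
        by rewrite ltnNge ltnW ?entry_mono.
      by rewrite !hT !entry_mono // => -[[-> _]|[_]] //; left.
    have hT (S : CST n i.+1) : (entry S u < entry S v)%N = false.
      by rewrite ltnNge ltnW ?entry_mono.
    by rewrite !hT !entry_mono // => -[[_]|[-> _]] //; right.
  move=> c d cm dm cd; left; rewrite !ez !ew (zl_mid hx cm) (zl_mid hx dm); split=> //.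
  apply: hm => //; have := xok _ _ cd (blk_mid cm dm).
  by rewrite /okp (zl_mid hx cm) (zl_mid hx dm) => -[[]|[]].
- apply: (@CST_eq _ _ (tableau i y.1) (tableau i (movex x p q 0).1)) => u.
  by rewrite eT /= mem_tableau_sw; exact: (entry_mem (tableau i x.1) u).
by rewrite cc_movex // mul0r addr0.
Qed.

Lemma edge_intro (R : realType) n (i : 'I_n) (x y : waf R n) (p q : letter n) (k : int) :
  in_WJaf [set~ i] x -> in_WJaf [set~ i] y -> p != q -> y = movex x p q k ->
  statA (lo i) (wfun x.1 \o sw p q) - statA (lo i) (wfun x.1)
    + 2 * (n + n - i)%N%:R * (k * \sum_(r in lo i) shift p q r) = 2 ->
  exists b, SiB_edge [set~ i] x b y.
Proof.
move=> hx hy pq ey h; apply: (movex_edge hx hy _ pq ey); apply/(si_diff hx hy).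
rewrite -[RHS]h ey cc_movex; last by have [] := (WJafP i x).1 hx.
rewrite [_ + _ - cc i x.2]addrC addKr; congr (_ - _ + _).
by apply: eq_statA => r _; rewrite wfun_comp wfun_wsw.
Qed.

Lemma edge_long (R : realType) n (i : 'I_n) (x y : waf R n) (s : 'I_i.+1)
    (T := tableau i x.1) (T' := tableau i y.1) :
  in_WJaf [set~ i] x -> in_WJaf [set~ i] y -> cc i y.2 = cc i x.2 ->
  (forall u, u != s -> entry T' u = entry T u) ->
  sigma (entry T' s) = entry T s -> (entry T s).+1 = n ->
  exists b, SiB_edge [set~ i] x b y.
Proof.
move=> hx hy ec h1 h2 h3; pose p := wfun x.1^-1%g (entry T s).
have ep : wfun x.1 p = entry T s by rewrite wfunKV.
have pl : p \in lo i by rewrite -(mem_tableau_wfun i x.1) ep entry_mem.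
have ey : y = movex x p (sigma p) 0.
  apply: (@movex0_eq _ _ i) => // [u|c d cm dm]; rewrite wfun_sigma ep.
    rewrite (@long_swT _ i x.1) ?entry_mem ?(entry_mem T) //.
    rewrite (inj_eq (@entry_inj _ _ T)); case: eqVneq => [->|us]; last exact: h1.
    by rewrite -/T -h2 sigmaK.
  have swc e : mid i e -> sw (entry T s) (sigma (entry T s)) (wfun x.1 e) = wfun x.1 e.
    move=> em; rewrite -ep -wfun_sigma sw_conj; [|exact: wfun_inj|exact: wfun_sigma].
    have [n1 n2] := lo_mid_neq pl em.
    by rewrite sw_out ?sigmaK // eq_sym // sigma_eq.
  by rewrite !swc.
apply: (edge_intro hx hy _ ey); first by rewrite neq_sigma.
rewrite mul0r mulr0 addr0.
by have := (stat_long x.1 0 pl).2; rewrite mulr0 addr0; apply; left; rewrite ep.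
Qed.

Lemma edge_short (R : realType) n (i : 'I_n) (x y : waf R n) (s t : 'I_i.+1)
    (T := tableau i x.1) (T' := tableau i y.1) :
  in_WJaf [set~ i] x -> in_WJaf [set~ i] y -> cc i y.2 = cc i x.2 -> (s < t)%N ->
  (forall u, u != s -> u != t -> entry T' u = entry T u) ->
  entry T' s = (entry T s).+1 :> nat -> (entry T s).+1 = sigma (entry T t) :> nat ->
  sigma (entry T t) = (sigma (entry T' t)).+1 :> nat ->
  exists b, SiB_edge [set~ i] x b y.
Proof.
move=> hx hy ec st h1 h2 h3 h4; pose p := wfun x.1^-1%g (entry T s).
pose r := wfun x.1^-1%g (entry T t).
have ep : wfun x.1 p = entry T s by rewrite wfunKV.
have er : wfun x.1 r = entry T t by rewrite wfunKV.
have pl : p \in lo i by rewrite -(mem_tableau_wfun i x.1) ep entry_mem.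
have rl : r \in lo i by rewrite -(mem_tableau_wfun i x.1) er entry_mem.
have nst : entry T s != entry T t by rewrite (inj_eq (@entry_inj _ _ T)) ord_lt_neq.
have pr : p != r by rewrite (inj_eq (@wfun_inj _ _)).
have e1 : entry T' s = sigma (entry T t) by apply: val_inj => /=; rewrite h2 h3.
have e2 : entry T' t = sigma (entry T s).
  apply: val_inj; move: h3 h4; rewrite /= ?sigmaE.
  by have := ltn_ord (entry T s); have := ltn_ord (entry T t); have := ltn_ord (entry T' t); clear; lia.
have ey : y = movex x p (sigma r) 0.
  apply: (@movex0_eq _ _ i) => // [u|c d cm dm]; rewrite wfun_sigma ep er.
    rewrite (@short_swT _ i x.1) ?entry_mem ?(entry_mem T) // -/T.
    rewrite !(inj_eq (@entry_inj _ _ T)); case: (eqVneq u s) => [->|us] //.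
    by case: (eqVneq u t) => [->|ut] //; exact: h1.
  have swc e : mid i e -> sw (entry T s) (sigma (entry T t)) (wfun x.1 e) = wfun x.1 e.
    move=> em; rewrite -ep -er -wfun_sigma sw_conj; [|exact: wfun_inj|exact: wfun_sigma].
    have [n1 n2] := lo_mid_neq pl em; have [m1 m2] := lo_mid_neq rl em.
    by rewrite sw_out ?sigmaK // eq_sym // sigma_eq.
  by rewrite !swc.
apply: (edge_intro hx hy _ ey); first exact: lo_neq_sigma pl rl.
rewrite mul0r mulr0 addr0.
have := (stat_short x.1 0 pl rl pr).2; rewrite mulr0 addr0; apply; split=> //; rewrite ep er.
by move: h3; rewrite sigmaE; have := ltn_ord (entry T s); have := ltn_ord (entry T t); clear; lia.
Qed.

(** Of the letters allowed here only [b] and [sigma b] move, to [a] and [sigma a], across gaps free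
    of allowed letters. Having [a] and [b] in the same half of the alphabet keeps the two gaps
    apart. *)
Lemma sw_mono n (a b c d : letter n) : (a < b)%N -> (a < n)%N = (b < n)%N ->
  (forall e : letter n, e = c \/ e = d -> [/\ e != a, sigma e != a,
     ~~ (a < e < b)%N & ~~ (a < sigma e < b)%N]) ->
  (c < d)%N -> (sw a b c < sw a b d)%N.
Proof.
move=> ab nab h cd; have [c1 c2 c3 c4] := h c (or_introl erefl).
have [d1 d2 d3 d4] := h d (or_intror erefl).
have swE (e : letter n) : e != a -> sigma e != a -> sw a b e =
    (if e == b :> nat then a : nat else
    if e == sigma b :> nat then sigma a : nat else e) :> nat.
  move=> e1 e2; rewrite /sw (negbTE e1) -[e == sigma a]sigma_eq (negbTE e2) -!val_eqE.
  by do !case: ifP.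
rewrite !swE //.
have := ord_neq_lt c1; have := ord_neq_lt c2; have := ord_neq_lt d1; have := ord_neq_lt d2.
rewrite !sigmaE in c4 d4 *.
move: ab nab c3 c4 d3 d4 cd (ltn_ord a) (ltn_ord b) (ltn_ord c) (ltn_ord d).
move: (a : nat) (b : nat) (c : nat) (d : nat) => y z u v; clear => *.
by do ?[case: eqP => ?]; lia.
Qed.

Lemma edge_mid (R : realType) n (i : 'I_n) (x y : waf R n) (s : 'I_i.+1)
    (T := tableau i x.1) (T' := tableau i y.1) :
  in_WJaf [set~ i] x -> in_WJaf [set~ i] y -> cc i y.2 = cc i x.2 ->
  (forall u, u != s -> entry T' u = entry T u) ->
  (entry T s < entry T' s)%N -> (entry T s < n)%N = (entry T' s < n)%N ->
  sigma (entry T' s) \notin val T ->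
  (forall d : letter n, (entry T s < d < entry T' s)%N -> sigma d \in val T) ->
  exists b, SiB_edge [set~ i] x b y.
Proof.
move=> hx hy ec h1 ab nab sbT gap; pose p := wfun x.1^-1%g (entry T s).
pose q := wfun x.1^-1%g (entry T' s).
have ep : wfun x.1 p = entry T s by rewrite wfunKV.
have eq : wfun x.1 q = entry T' s by rewrite wfunKV.
have pl : p \in lo i by rewrite -(mem_tableau_wfun i x.1) ep entry_mem.
have bT : entry T' s \notin val T.
  apply/negP => /entry_surj[u eu]; have [us|us] := eqVneq u s.
    by move: ab; rewrite eu us ltnn.
  by move: (h1 _ us); rewrite -eu => /entry_inj e; rewrite e eqxx in us.
have qm : mid i q.
  move: bT sbT; rewrite -eq -wfun_sigma /T /= !mem_tableau_wfun !inE /mid.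
  by rewrite -!ltnNge => -> ->.
have ey : y = movex x p q 0.
  apply: (@movex0_eq _ _ i) => // [u|c d cm dm cd].
    rewrite (mid_swT pl qm) ?entry_mem ?(entry_mem T) // ep eq -/T.
    by rewrite (inj_eq (@entry_inj _ _ T)); case: eqVneq => [->|us] //; exact: h1.
  apply: sw_mono => //; rewrite ?ep ?eq // => e ee.
  have em : wfun x.1 c \notin val T /\ sigma (wfun x.1 c) \notin val T.
    exact: (@mid_notin _ i x.1 c).
  have dm' : wfun x.1 d \notin val T /\ sigma (wfun x.1 d) \notin val T.
    exact: (@mid_notin _ i x.1 d).
  have [n1 n2] : e \notin val T /\ sigma e \notin val T by case: ee => ->.
  split.
  - by apply: contraNneq n1 => ->; exact: entry_mem.
  - by apply: contraNneq n2 => ->; exact: entry_mem.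
  - by apply: contraNN n2 => /gap.
  by apply: contraNN n1 => /gap; rewrite sigmaK.
apply: (edge_intro hx hy _ ey); first by have [] := lo_mid_neq pl qm.
rewrite mul0r mulr0 addr0; apply/(stat_mid _ pl qm); rewrite ep eq; split=> // d hd.
have sT := gap _ hd; exists (wfun x.1^-1%g (sigma d)); last by rewrite wfunKV sigmaK.
rewrite in_setD1 -(mem_tableau_wfun i x.1) wfunKV sT andbT (inj_eq (@wfun_inj _ _)).
(* Such a [d] would lie in the half of the alphabet opposite to [entry T s], hence outside the
   gap. *)
apply/eqP => e; have ed : d = sigma (entry T s) by rewrite -e sigmaK.
move: hd nab (ltn_ord (entry T s)) (ltn_ord (entry T' s)); rewrite ed sigmaE; clear.
by lia.
Qed.

(** In terms of kappa the value at [p] goes from [2n - 1 + 2n * z] to [2n * (z + 1)], one step up.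
    No other letter of the first block has the value 1 or 1bar, so the inequalities defining
    (W^J)_af persist. *)
Lemma edge_wrap (R : realType) n (i : 'I_n) (x y : waf R n)
    (T := tableau i x.1) (T' := tableau i y.1) :
  in_WJaf [set~ i] x -> in_WJaf [set~ i] y -> cc i y.2 = cc i x.2 + 1 ->
  entry T' ord0 = 0%N :> nat ->
  (forall u v : 'I_i.+1, u = v.+1 :> nat -> entry T' u = entry T v) ->
  (entry T ord_max).+1 = (n + n)%N ->
  exists b, SiB_edge [set~ i] x b y.
Proof.
move=> hx hy ec h0 h1 h2; have [xi xok] := (WJafP i x).1 hx.
pose p := wfun x.1^-1%g (entry T ord_max).
have ep : wfun x.1 p = entry T ord_max by rewrite wfunKV.
have aT : entry T ord_max \in tableau_set i x.1 by exact: (entry_mem T).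
have pl : p \in lo i by rewrite -(mem_tableau_wfun i x.1) ep.
have ew c : c \in lo i -> wfun (movex x p (sigma p) 1).1 c =
    if c == p then sigma (entry T ord_max) else wfun x.1 c.
  move=> cl; rewrite wfun_comp wfun_wsw -sw_conj; [|exact: wfun_inj|exact: wfun_sigma].
  rewrite wfun_sigma ep (@long_swT _ i x.1) ?mem_tableau_wfun //.
  by rewrite -ep (inj_eq (@wfun_inj _ _)).
have ez c : c \in lo i -> zl (movex x p (sigma p) 1).2 c = zl x.2 c + (p == c)%:R.
  by move=> cl; rewrite zl_movex // mul1r (shift_long pl cl).
have sumE : \sum_(r in lo i) shift p (sigma p) r = 1.
  by rewrite (eq_bigr _ (fun r rl => shift_long pl rl)) sum_eq_lo.
have ey : y = movex x p (sigma p) 1.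
  apply: (@Ymap_inj _ _ i) => //.
  - apply: WJaf_intro; first exact: integral_movex.
      move=> c d cl dl cd; have := xok _ _ cd (blk_lo _ _).
      move: (cl) (dl); rewrite !inE => -> -> /(_ isT isT); rewrite /okp !ez // !ew //.
      have bnd e : e \in lo i -> e != p ->
          (sigma (entry T ord_max) < wfun x.1 e < entry T ord_max)%N.
        move=> el ne; have eT : wfun x.1 e \in tableau_set i x.1 by rewrite mem_tableau_wfun.
        have := ord_neq_lt (tableau_neq_sigma eT aT).
        have : wfun x.1 e != entry T ord_max by rewrite -ep (inj_eq (@wfun_inj _ _)).
        move/ord_neq_lt; have := ltn_ord (wfun x.1 e); rewrite sigmaE; move: h2; clear; lia.
      have [ecp|cp] := eqVneq c p; have [edp|dp] := eqVneq d p.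
      + by move: cd; rewrite ecp edp ltnn.
      + have pd : (p == d) = false by rewrite eq_sym (negbTE dp).
        have := bnd _ dl dp; rewrite ecp ?eqxx ?pd ep.
        by move: (zl _ _) (zl _ _) => u v; clear; lia.
      + have pc : (p == c) = false by rewrite eq_sym (negbTE cp).
        have := bnd _ cl cp; rewrite edp ?eqxx ?pc ep.
        by move: (zl _ _) (zl _ _) => u v; clear; lia.
      by rewrite ?[p == c]eq_sym ?[p == d]eq_sym ?(negbTE cp) ?(negbTE dp) !addr0.
    move=> c d cm dm cd; have [p1 p2] := lo_mid_neq pl cm; have [q1 q2] := lo_mid_neq pl dm.
    have := xok _ _ cd (blk_mid cm dm); rewrite /okp !zl_movex // !wfun_comp !wfun_wsw.
    rewrite /shift eqxx (negbTE p1) (negbTE p2) (negbTE q1) (negbTE q2) subrr mulr0 !addr0.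
    by rewrite !sw_out ?sigmaK // eq_sym // sigma_eq.
  - apply: (@CST_eq _ _ (tableau i y.1) (tableau i (movex x p (sigma p) 1).1)) => u.
    have mem c : c \in tableau_set i x.1 ->
        (if c == entry T ord_max then sigma (entry T ord_max) else c)
          \in tableau_set i (movex x p (sigma p) 1).1.
      by move=> cT; rewrite -(long_swT aT cT) -ep -wfun_sigma mem_tableau_sw.
    have [u0|u0] := posnP u.
      have -> : entry (tableau i y.1) u = sigma (entry T ord_max).
        have -> : u = ord0 by apply: val_inj.
        by apply: val_inj; rewrite /= h0; move: h2; clear; lia.
      by have := mem _ aT; rewrite eqxx.
    have ui : (u.-1 < i.+1)%N by have := ltn_ord u; lia.
    rewrite (h1 _ (Ordinal ui)) /=; last by rewrite prednK.
    have := mem _ (entry_mem T (Ordinal ui)); rewrite (inj_eq (@entry_inj _ _ T)).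
    rewrite -val_eqE /= (_ : (u.-1 == i) = false) //.
    by apply/negbTE; have := ltn_ord u; move: u0; clear; lia.
  by rewrite cc_movex // sumE mulr1.
apply: (edge_intro hx hy _ ey); first by rewrite neq_sigma.
by rewrite sumE mul1r; apply/(stat_long _ _ pl); right; rewrite ep.
Qed.

Lemma edge_rise (R : realType) n (i : 'I_n) (x y : waf R n) (s : 'I_i.+1)
    (T := tableau i x.1) (T' := tableau i y.1) :
  in_WJaf [set~ i] x -> in_WJaf [set~ i] y -> cc i y.2 = cc i x.2 ->
  (forall u, u != s -> entry T' u = entry T u) -> rise T T' s ->
  exists b, SiB_edge [set~ i] x b y.
Proof.
move=> hx hy ec h1 [an [bmem bmin]].
move: bmem; rewrite !inE => /andP[bn /andP[ab bn']].
apply: (edge_mid hx hy ec h1 ab); first by rewrite bn' (ltn_trans ab bn').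
  apply: contraNN bn => /entry_surj[u eu]; apply/imsetP; exists u.
    by rewrite inE -eu sigma_geq.
  by rewrite -eu lnorm_ge ?sigmaK // sigma_geq.
move=> d /andP[ad db]; apply: contraLR db => sT; rewrite -leqNgt.
have [nd|dn] := leqP n d; first exact: leq_trans (ltnW bn') nd.
apply: bmin; rewrite !inE ad dn !andbT; apply: contraNN sT => /imsetP[u].
by rewrite inE => nu ->; rewrite lnorm_ge // sigmaK entry_mem.
Qed.

Lemma edge_rise_bar (R : realType) n (i : 'I_n) (x y : waf R n) (s : 'I_i.+1)
    (T := tableau i x.1) (T' := tableau i y.1) :
  in_WJaf [set~ i] x -> in_WJaf [set~ i] y -> cc i y.2 = cc i x.2 ->
  (forall u, u != s -> entry T' u = entry T u) -> rise_bar T T' s ->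
  exists b, SiB_edge [set~ i] x b y.
Proof.
move=> hx hy ec h1 [na _ [c [cmem cmax] eb]].
move: cmem cmax; rewrite lnorm_ge // !inE => /andP[cT ca] cmax.
have cn : (c < n)%N by apply: ltn_trans ca _; rewrite sigma_ltn.
have ab : (entry T s < entry T' s)%N by rewrite eb -ltn_sigma sigmaK.
apply: (edge_mid hx hy ec h1 ab).
- by rewrite eb !ltnNge na sigma_geq cn.
- rewrite eb sigmaK; apply: contraNN cT => /entry_surj[u eu].
  by apply/imsetP; exists u; rewrite ?inE -?eu.
rewrite eb => d /andP[ad db]; apply: contraLR db => sT; rewrite -leqNgt -ltnS ltnNge.
rewrite -[d]sigmaK; apply/negP => l.
have : (sigma d <= c)%N; last by move: l; rewrite sigmaK !sigmaE; have := ltn_ord d; have := ltn_ord c; clear; lia.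
apply: cmax; rewrite !inE ltn_sigma ad andbT; apply: contraNN sT => /imsetP[u _ ->].
exact: entry_mem.
Qed.

Theorem proposition4p19 (R : realType) (n : nat) (hn : (2 <= n)%N) (i : 'I_n)
    (x y : waf R n) (hx : in_WJaf [set~ i] x) (hy : in_WJaf [set~ i] y)
    (T T' : CST n i.+1) (c c' : int)
    (hYx : Ymap i x = (T, c)) (hYy : Ymap i y = (T', c')) :
  (exists b : aff R n, SiB_edge [set~ i] x b y)
  <->
  (* (1) *)
      [/\ (i.+1 < n)%N, c' = c &
        exists s : 'I_i.+1,
          [/\ forall u, u != s -> entry T' u = entry T u,
              ((entry T s).+1 < n)%N &
              is_min ([set a : letter n | (entry T s < a)%N && (a < n)%N]
                      :\: [set lnorm (entry T u) | u : 'I_i.+1 & (n <= entry T u)%N])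
                     (entry T' s)]]
  \/ (* (2) *)
      [/\ (i.+1 < n)%N, c' = c &
        exists s : 'I_i.+1,
          [/\ forall u, u != s -> entry T' u = entry T u,
              (n <= entry T s)%N, ((entry T s).+1 < n + n)%N &
              exists2 a : letter n,
                is_max ([set a : letter n | (a < lnorm (entry T s))%N]
                        :\: [set entry T u | u : 'I_i.+1 & (entry T u < n)%N])
                       a
              & entry T' s = sigma a]]
  \/ (* (3) *)
      [/\ (0 < i)%N, c' = c &
        exists s t : 'I_i.+1,
          [/\ (s < t)%N,
              forall u, u != s -> u != t -> entry T' u = entry T u &
              [/\ entry T' s = (entry T s).+1 :> nat,
                  (entry T s).+1 = sigma (entry T t) :> nat,
                  sigma (entry T t) = (sigma (entry T' t)).+1 :> nat &
                  (sigma (entry T' t)).+1 < n]%N]]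
  \/ (* (4) *)
      (c' = c /\
        exists s : 'I_i.+1,
          [/\ forall u, u != s -> entry T' u = entry T u,
              sigma (entry T' s) = entry T s &
              (entry T s).+1 = n])
  \/ (* (5) *)
      [/\ c' = c + 1,
          entry T' ord0 = 0%N :> nat,
          forall u v : 'I_i.+1, u = v.+1 :> nat -> entry T' u = entry T v &
          (entry T ord_max).+1 = (n + n)%N].
Proof.
have [xi _] := (WJafP i x).1 hx; have [yi _] := (WJafP i y).1 hy.
move: hYx hYy; rewrite /Ymap !coroot_coefE // => -[<- <-] [<- <-].
split=> [/edge_movex[sl [p [q [k [hpq ey]]]]]|].
  move: (hy) sl; rewrite ey => hy' sl; have := movex_inv hn hx hy' sl hpq.
  have c0 : k = 0 -> cc i (movex x p q k).2 = cc i x.2.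
    by move=> ->; rewrite cc_movex // mul0r addr0.
  case=> [[pl qm k0 ab gap]|[pl eq k0 an]|[pl eq k1 an]|[t [pl tl pt eq [k0 an]]]].
  (* A middle letter exists only if the index is not n; hence the restriction on it in cases (1) and
     (2). *)
  - have i1n : (i.+1 < n)%N.
      move: qm (ltn_ord q); rewrite /mid sigmaE; have := ltn_ord i; clear; lia.
    have [s h1 [[h2 h3]|[h2 h3 h4]]] := entry_mid pl qm ab gap; [left|right; left].
      by split; [|exact: c0|exists s].
    by split; [|exact: c0|exists s].
  - rewrite eq in c0 *; do 3!right; left; split; first exact: c0.
    exact: entry_long pl an.
  - rewrite eq in c0 *; do 4!right; have [h1 h2 h3] := entry_wrap pl an; split=> //.
    rewrite cc_movex // k1 mul1r; congr (_ + _).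
    by rewrite (eq_bigr _ (fun r rl => shift_long pl rl)) sum_eq_lo.
  rewrite eq in c0 *; do 2!right; left.
  by have [h1 h2] := entry_short pl tl pt an; split; [|exact: c0|].
case=> [[_ ec [s [h1 h2 h3]]]|[[_ ec [s [h1 h2 h3 h4]]]|[[_ ec [s [t [st h1 [h2 h3 h4 _]]]]]|[[ec [s [h1 h2 h3]]]|[ec h0 h1 h2]]]]].
- by apply: (edge_rise hx hy ec h1).
- by apply: (edge_rise_bar hx hy ec h1).
- exact: (edge_short hx hy ec st h1 h2 h3 h4).
- exact: (edge_long hx hy ec h1 h2 h3).
exact: (edge_wrap hx hy ec h0 h1 h2).
Qed.
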